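(* Let $G$ be a finite group. (a) One has $\iota(B(G)^\times)=\iota(B(G))\cap B^\Delta_\circ(G,G)$, and $\iota(B(G)^\times)$ is a normal subgroup of $B^\Delta_\circ(G,G)$. (b) The ring homomorphism $\eta\colon\mathbb{Z}\mathrm{Out}(G)\to B^\Delta(G,G)$ restricts to an injective group homomorphism $\eta\colon\mathrm{Out}(G)\to B^\Delta_\circ(G,G)$. (c) For each $\gamma\in B^\Delta_\circ(G,G)$ there exist a unique $\overline{\phi}\in\mathrm{Out}(G)$ and a unique $\epsilon\in\{\pm1\}$ such that $\rho(\gamma)=\epsilon\cdot\overline{\phi}$. Moreover, the resulting map $\pi\colon B^\Delta_\circ(G,G)\to\mathrm{Out}(G)$, $\gamma\mapsto\overline{\phi}$, is a surjective group homomorphism with $\pi\circ\eta=\mathrm{id}_{\mathrm{Out}(G)}$. (d) Set $\Lambda_G:=\ker(\pi)\trianglelefteq B^\Delta_\circ(G,G)$ and $\Delta_G:=\eta(\mathrm{Out}(G))\le B^\Delta_\circ(G,G)$. Then $\iota(B(G)^\times)\le\Lambda_G$, and $B^\Delta_\circ(G,G)=\Lambda_G\rtimes\Delta_G$ is a semidirect product. (e) For $\overline{\phi}\in\mathrm{Out}(G)$ and $u\in B(G)^\times$ one has $\eta(\overline{\phi})\cdot_G\iota(u)\cdot_G\eta(\overline{\phi})^{-1}=\iota({}^{\overline{\phi}}u)$.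
   Context: For a finite group $G$, subgroups $R,S\le G$ and an isomorphism $\alpha\colon S\to R$, put $\Delta(R,\alpha,S)=\{(\alpha(s),s)\mid s\in S\}\le G\times G$ (a twisted diagonal subgroup) and $\Delta(R)=\Delta(R,\mathrm{id}_R,R)$. $B(G)$ is the Burnside ring of $G$, with unit group $B(G)^\times$. $B^\Delta(G,G)$ is the Grothendieck group (with respect to disjoint union) of finite bifree $(G,G)$-bisets (free as left $G$-set and as right $G$-set), identified with left $(G\times G)$-sets via $(g,h)\cdot x=gxh^{-1}$; it has $\mathbb{Z}$-basis $[(G\times G)/L]$, with $L$ running over representatives of the $(G\times G)$-conjugacy classes of twisted diagonal subgroups. The tensor product of bisets $X\times_G Y$ (orbits of $X\times Y$ under $g\cdot(x,y)=(xg^{-1},gy)$) induces a multiplication $\cdot_G$ making $B^\Delta(G,G)$ a ring with identity $[G]=[(G\times G)/\Delta(G)]$. The anti-involution $-^\circ$ on $B^\Delta(G,G)$ is given by $[(G\times G)/L]\mapsto[(G\times G)/L^\circ]$, $L^\circ=\{(h,g)\mid(g,h)\in L\}$. The group of orthogonal units is $B^\Delta_\circ(G,G)=\{\gamma\in B^\Delta(G,G)\mid\gamma\cdot_G\gamma^\circ=[G]=\gamma^\circ\cdot_G\gamma\}$, a group under $\cdot_G$. The following maps are ring homomorphisms: - $\iota\colon B(G)\to B^\Delta(G,G)$, $[G/R]\mapsto[(G\times G)/\Delta(R)]$ (injective); - $\eta\colon\mathbb{Z}\mathrm{Out}(G)\to B^\Delta(G,G)$, $\overline{\phi}\mapsto[(G\times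 G)/\Delta(G,\phi,G)]$, where $\mathrm{Out}(G)$ is the outer automorphism group, $\overline{\phi}$ denotes the class of $\phi\in\mathrm{Aut}(G)$, and $\mathbb{Z}\mathrm{Out}(G)$ is the integral group ring; - $\rho\colon B^\Delta(G,G)\to\mathbb{Z}\mathrm{Out}(G)$, $[(G\times G)/\Delta(R,\alpha,S)]\mapsto\overline{\alpha}$ if $R=S=G$, and $\mapsto0$ otherwise. $\mathrm{Out}(G)$ acts on $B(G)$ by ring automorphisms via ${}^{\overline{\phi}}[G/R]=[G/\phi(R)]$, and hence on $B(G)^\times$. *)

(* Defs.v *)
From HB Require Import structures.
From mathcomp Require Import all_boot all_order all_algebra all_fingroup.
From mathcomp Require Import generic_quotient.
From mathcomp Require Import boolp.

Set Implicit Arguments.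
Unset Strict Implicit.
Unset Printing Implicit Defensive.

Import GRing.Theory.
Local Open Scope ring_scope.
Local Open Scope quotient_scope.

(* Grothendieck group of a commutative monoid, and Grothendieck ring of a     *)
(* semiring: classes of formal differences p.1 - p.2.                         *)

Section GrothendieckGroup.

Variable M : nmodType.

Definition groth_rel (p q : M * M) : bool :=
  `[< exists e, p.1 + q.2 + e = q.1 + p.2 + e >].

Lemma groth_relP p q :
  reflect (exists e, p.1 + q.2 + e = q.1 + p.2 + e) (groth_rel p q).
Proof. exact: asboolP. Qed.

Lemma groth_rel_refl : reflexive groth_rel.
Proof. by move=> p; apply/groth_relP; exists 0. Qed.

Lemma groth_rel_sym : symmetric groth_rel.
Proof.
by move=> p q; apply/groth_relP/groth_relP => -[e E]; exists e; rewrite E.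
Qed.

Lemma groth_rel_trans : transitive groth_rel.
Proof.
move=> [c d] [a b] [u v] /groth_relP [e /= E] /groth_relP [h /= H].
apply/groth_relP; exists (c + d + e + h) => /=.
have -> : a + v + (c + d + e + h) = (a + d + e) + (c + v + h).
  by rewrite [LHS](AC (2*4) ((1*4*5)*(3*2*6))) /=.
by rewrite E H [LHS](AC (3*3) ((4*2)*(1*5*3*6))) /=.
Qed.

Canonical groth_equiv :=
  EquivRel groth_rel groth_rel_refl groth_rel_sym groth_rel_trans.

Definition groth := {eq_quot groth_equiv}.
HB.instance Definition _ := Choice.on groth.
HB.instance Definition _ := EqQuotient.on groth.

Definition gpair (a b : M) : groth := \pi_groth (a, b).

Lemma eq_gpair a b c d :
  gpair a b = gpair c d <-> exists e, a + d + e = c + b + e.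
Proof.
split=> [/eqP|[e E]].
  by rewrite /gpair eqmodE => /groth_relP.
by apply/eqP; rewrite /gpair eqmodE; apply/groth_relP; exists e.
Qed.

Lemma groth_ind (P : groth -> Prop) :
  (forall a b, P (gpair a b)) -> forall x, P x.
Proof. by move=> H x; rewrite -[x]reprK; case: (repr x) => a b; apply: H. Qed.

Lemma gpair_repr a b :
  exists e, (repr (gpair a b)).1 + b + e = a + (repr (gpair a b)).2 + e.
Proof.
apply/(eq_gpair _ _ a b).
by rewrite /gpair -surjective_pairing reprK.
Qed.

Definition groth_add (x y : groth) : groth :=
  gpair ((repr x).1 + (repr y).1) ((repr x).2 + (repr y).2).
Definition groth_opp (x : groth) : groth := gpair (repr x).2 (repr x).1.

Lemma groth_addE a b c d :
  groth_add (gpair a b) (gpair c d) = gpair (a + c) (b + d).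
Proof.
apply/eq_gpair; have [e E] := gpair_repr a b; have [h H] := gpair_repr c d.
exists (e + h); set p := repr _ in E *; set q := repr (gpair c d) in H *.
rewrite [LHS](AC (2*2*2) ((1*3*5)*(2*4*6))) /= E H.
by rewrite [LHS](AC (3*3) ((1*4)*(2*5)*(3*6))) /=.
Qed.

Lemma groth_oppE a b : groth_opp (gpair a b) = gpair b a.
Proof.
apply/eq_gpair; have [e E] := gpair_repr a b; exists e.
by rewrite [_.2 + a]addrC -E [_.1 + b]addrC.
Qed.

Lemma groth_addA : associative groth_add.
Proof.
elim/groth_ind=> a b; elim/groth_ind=> c d; elim/groth_ind=> u v.
by rewrite !groth_addE !addrA.
Qed.

Lemma groth_addC : commutative groth_add.
Proof.
elim/groth_ind=> a b; elim/groth_ind=> c d.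
by rewrite !groth_addE addrC [b + d]addrC.
Qed.

Lemma groth_add0 : left_id (gpair 0 0) groth_add.
Proof. by elim/groth_ind=> a b; rewrite groth_addE !add0r. Qed.

Lemma groth_addN : left_inverse (gpair 0 0) groth_opp groth_add.
Proof.
elim/groth_ind=> a b; rewrite groth_oppE groth_addE.
by apply/eq_gpair; exists 0; rewrite !addr0 add0r addrC.
Qed.

HB.instance Definition _ :=
  GRing.isZmodule.Build groth groth_addA groth_addC groth_add0 groth_addN.

Lemma gpairD a b c d : gpair a b + gpair c d = gpair (a + c) (b + d).
Proof. exact: groth_addE. Qed.

Lemma gpairN a b : - gpair a b = gpair b a.
Proof. exact: groth_oppE. Qed.

Definition groth_of (a : M) : groth := gpair a 0.

Lemma groth_ofD a b : groth_of (a + b) = groth_of a + groth_of b.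
Proof. by rewrite gpairD addr0. Qed.

Lemma gpairE a b : gpair a b = groth_of a - groth_of b.
Proof. by rewrite gpairN gpairD addr0 add0r. Qed.

(* The additive extension of an additive map f : M -> V.                      *)
Definition groth_lift (V : zmodType) (f : M -> V) (x : groth) : V :=
  f (repr x).1 - f (repr x).2.

Lemma groth_liftE (V : zmodType) (f : M -> V) :
  {morph f : a b / a + b} ->
  forall a b, groth_lift f (gpair a b) = f a - f b.
Proof.
move=> fD a b; rewrite /groth_lift; have [e] := gpair_repr a b.
set p := repr _ => /(congr1 f); rewrite !fD => /addIr E.
by apply/eqP; rewrite subr_eq addrAC -E addrK.
Qed.

Lemma groth_liftD (V : zmodType) (f : M -> V) :
  {morph f : a b / a + b} -> {morph groth_lift f : x y / x + y}.
Proof.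
move=> fD; elim/groth_ind=> a b; elim/groth_ind=> c d.
by rewrite gpairD !groth_liftE // !fD opprD addrACA.
Qed.

Lemma groth_lift_of (V : zmodType) (f : M -> V) :
  {morph f : a b / a + b} -> forall a, groth_lift f (groth_of a) = f a.
Proof.
move=> fD a; rewrite groth_liftE //.
by have /(congr1 (fun x => x - f 0)) := fD 0 0; rewrite addr0 subrr addrK => <-; rewrite subr0.
Qed.

End GrothendieckGroup.

Section GrothendieckRing.

Variable R : pzSemiRingType.
Implicit Types a b c d : R.

Definition groth_mul (x y : groth R) : groth R :=
  gpair ((repr x).1 * (repr y).1 + (repr x).2 * (repr y).2)
        ((repr x).1 * (repr y).2 + (repr x).2 * (repr y).1).

Fact groth_mul_eql x y x' y' z w k : x' + y + k = x + y' + k ->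
  gpair (x' * z + y' * w) (x' * w + y' * z) =
  gpair (x * z + y * w) (x * w + y * z) :> groth R.
Proof.
move=> K; apply/eq_gpair; exists (k * z + k * w).
rewrite [LHS](AC (2*2*2) ((1*4*5)*(3*2*6))) /=.
rewrite [RHS](AC (2*2*2) ((1*4*5)*(3*2*6))) /=.
by rewrite -!mulrDl K.
Qed.

Fact groth_mul_eqr x y x' y' z w k : x' + y + k = x + y' + k ->
  gpair (z * x' + w * y') (z * y' + w * x') =
  gpair (z * x + w * y) (z * y + w * x) :> groth R.
Proof.
move=> K; apply/eq_gpair; exists (z * k + w * k).
rewrite [LHS](AC (2*2*2) ((1*3*5)*(4*2*6))) /=.
rewrite [RHS](AC (2*2*2) ((1*3*5)*(4*2*6))) /=.
by rewrite -!mulrDr K.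
Qed.

Lemma groth_mulE a b c d :
  groth_mul (gpair a b) (gpair c d) = gpair (a * c + b * d) (a * d + b * c).
Proof.
rewrite /groth_mul; have [e E] := gpair_repr a b; have [h H] := gpair_repr c d.
by rewrite (groth_mul_eql _ _ E) (groth_mul_eqr _ _ H).
Qed.

Lemma groth_mulA : associative groth_mul.
Proof.
elim/groth_ind=> a b; elim/groth_ind=> c d; elim/groth_ind=> u v.
rewrite !groth_mulE !mulrDr !mulrDl !mulrA; congr gpair.
  by rewrite [LHS](AC (2*2) ((1*4)*(2*3))) /=.
by rewrite [LHS](AC (2*2) ((1*4)*(2*3))) /=.
Qed.

Lemma groth_mul1 : left_id (groth_of 1) groth_mul.
Proof.
by elim/groth_ind=> a b; rewrite groth_mulE !mul1r !mul0r !addr0.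
Qed.

Lemma groth_mulr1 : right_id (groth_of 1) groth_mul.
Proof.
by elim/groth_ind=> a b; rewrite groth_mulE !mulr1 !mulr0 addr0 add0r.
Qed.

Lemma groth_mulDl : left_distributive groth_mul +%R.
Proof.
elim/groth_ind=> a b; elim/groth_ind=> c d; elim/groth_ind=> u v.
by rewrite gpairD !groth_mulE gpairD !mulrDl; congr gpair; rewrite addrACA.
Qed.

Lemma groth_mulDr : right_distributive groth_mul +%R.
Proof.
elim/groth_ind=> a b; elim/groth_ind=> c d; elim/groth_ind=> u v.
by rewrite gpairD !groth_mulE gpairD !mulrDr; congr gpair; rewrite addrACA.
Qed.

HB.instance Definition _ := GRing.Zmodule_isPzRing.Build (groth R)
  groth_mulA groth_mul1 groth_mulr1 groth_mulDl groth_mulDr.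

Lemma gpairM a b c d :
  gpair a b * gpair c d = gpair (a * c + b * d) (a * d + b * c).
Proof. exact: groth_mulE. Qed.

Lemma groth_ofM a b : groth_of (a * b) = groth_of a * groth_of b.
Proof. by rewrite gpairM !mul0r !mulr0 !addr0. Qed.

Lemma groth_of1 : groth_of 1 = 1 :> groth R.
Proof. by []. Qed.

End GrothendieckRing.

Lemma groth_mulC (R : comPzSemiRingType) : commutative (@groth_mul R).
Proof.
elim/groth_ind=> a b; elim/groth_ind=> c d; rewrite !groth_mulE.
by rewrite (mulrC a c) (mulrC b d) (mulrC a d) (mulrC b c) [X in gpair _ X]addrC.
Qed.

(* Finite left H-sets are encoded as right actions, h . x := to x h^-1; the   *)
(* orbits, stabilisers and equivariant maps are the same for both.            *)

Definition act_iso (hT : finGroupType) (T1 T2 : finType)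
    (to1 : {action hT &-> T1}) (to2 : {action hT &-> T2}) : Prop :=
  exists2 f : T1 -> T2, bijective f & forall x a, f (to1 x a) = to2 (f x) a.

Section ActionIsomorphism.

Variable hT : finGroupType.

Lemma act_iso_refl (T : finType) (to : {action hT &-> T}) : act_iso to to.
Proof. by exists id => //; exists id. Qed.

Lemma act_iso_sym (T1 T2 : finType) (to1 : {action hT &-> T1})
  (to2 : {action hT &-> T2}) : act_iso to1 to2 -> act_iso to2 to1.
Proof.
case=> f [g fK gK] fJ; exists g; first by exists f.
by move=> x a; apply: (canLR fK); rewrite fJ gK.
Qed.

Lemma act_iso_trans (T1 T2 T3 : finType) (to1 : {action hT &-> T1})
    (to2 : {action hT &-> T2}) (to3 : {action hT &-> T3}) :
  act_iso to1 to2 -> act_iso to2 to3 -> act_iso to1 to3.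
Proof.
case=> f f_bij fJ [g g_bij gJ]; exists (g \o f); first exact: bij_comp.
by move=> x a /=; rewrite fJ gJ.
Qed.

Lemma act_iso_surj (P : Type) (T1 T2 : finType) (to1 : {action hT &-> T1})
    (to2 : {action hT &-> T2}) (p : P -> T1) (q : P -> T2) :
    (forall x, exists u, p u = x) -> (forall y, exists u, q u = y) ->
    (forall u v, p u = p v <-> q u = q v) ->
    (forall u a, exists2 v, p v = to1 (p u) a & q v = to2 (q u) a) ->
  act_iso to1 to2.
Proof.
move=> /choice[p' pK] /choice[q' qK] pq pqJ.
have pqE u : q (p' (p u)) = q u by apply/pq; rewrite pK.
have qpE u : p (q' (q u)) = p u by apply/pq; rewrite qK.
exists (q \o p'); first by exists (p \o q') => x /=; rewrite ?qpE ?pqE.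
by move=> x a /=; have [v Ev <-] := pqJ (p' x) a; rewrite pK in Ev; rewrite -Ev.
Qed.

End ActionIsomorphism.

Section ActionConstructions.

Variable hT : finGroupType.

Section Transport.
Variables (T : finType) (to : {action hT &-> T}).
Definition ord_act (i : 'I_#|T|) a := enum_rank (to (enum_val i) a).
Fact ord_act1 : ord_act^~ 1%g =1 id.
Proof. by move=> i; rewrite /ord_act act1 enum_valK. Qed.
Fact ord_actM i : act_morph ord_act i.
Proof. by move=> a b; rewrite /ord_act actM enum_rankK. Qed.
Definition ord_action := TotalAction ord_act1 ord_actM.
Lemma ord_action_iso : act_iso to ord_action.
Proof.
exists enum_rank; first by exists enum_val; [exact: enum_rankK | exact: enum_valK].
by move=> x a; rewrite /= /ord_act enum_rankK.
Qed.
End Transport.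

Definition void_act (x : void) (a : hT) := x.
Definition void_action :=
  TotalAction (fun _ => erefl : void_act _ 1%g = _) (fun _ _ _ => erefl).

Definition unit_act (x : unit) (a : hT) := x.
Definition unit_action :=
  TotalAction (fun _ => erefl : unit_act _ 1%g = _) (fun _ _ _ => erefl).

Section SumProd.
Variables (T1 T2 : finType) (to1 : {action hT &-> T1}) (to2 : {action hT &-> T2}).

Definition sum_act (u : T1 + T2) a : T1 + T2 :=
  match u with inl x => inl (to1 x a) | inr y => inr (to2 y a) end.
Fact sum_act1 : sum_act^~ 1%g =1 id.
Proof. by case=> x /=; rewrite act1. Qed.
Fact sum_actM u : act_morph sum_act u.
Proof. by case: u => x a b /=; rewrite actM. Qed.
Definition sum_action := TotalAction sum_act1 sum_actM.

Definition prod_act (u : T1 * T2) a := (to1 u.1 a, to2 u.2 a).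
Fact prod_act1 : prod_act^~ 1%g =1 id.
Proof. by case=> x y; rewrite /prod_act !act1. Qed.
Fact prod_actM u : act_morph prod_act u.
Proof. by move=> a b; rewrite /prod_act !actM. Qed.
Definition prod_action := TotalAction prod_act1 prod_actM.
End SumProd.

(* The set H/L of left cosets, with h . A = h *: A.                           *)
Section Coset.
Variable L : {group hT}.
Definition coset_type := {A : {set hT} | A \in lcosets L [set: hT]}.
Fact coset_act_proof (A : coset_type) a :
  (a^-1 *: val A)%g \in lcosets L [set: hT].
Proof.
case: A => A /= /lcosetsP[x _ ->]; apply/lcosetsP; exists (a^-1 * x)%g => //.
by rewrite lcosetM.
Qed.
Definition coset_act (A : coset_type) a : coset_type :=
  Sub (a^-1 *: val A)%g (coset_act_proof A a).
Fact coset_act1 : coset_act^~ 1%g =1 id.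
Proof. by move=> A; apply: val_inj; rewrite /= invg1 lcoset1. Qed.
Fact coset_actM A : act_morph coset_act A.
Proof. by move=> a b; apply: val_inj; rewrite /= invMg lcosetM. Qed.
Definition coset_action := TotalAction coset_act1 coset_actM.

Fact coset_base_proof : (L : {set hT}) \in lcosets L [set: hT].
Proof. by apply/lcosetsP; exists 1%g; rewrite ?lcoset1. Qed.
Definition coset_base : coset_type := Sub (L : {set hT}) coset_base_proof.
End Coset.

End ActionConstructions.

(* Isomorphism classes of finite H-sets; every finite H-set is isomorphic to  *)
(* one with carrier 'I_n.                                                     *)

Record gset (hT : finGroupType) :=
  GSet { gset_card : nat; gset_act : {action hT &-> 'I_gset_card} }.

HB.instance Definition _ (hT : finGroupType) := gen_eqMixin (gset hT).
HB.instance Definition _ (hT : finGroupType) := gen_choiceMixin (gset hT).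

Section GSetClasses.

Variable hT : finGroupType.

Definition gset_rel (X Y : gset hT) : bool :=
  `[< act_iso (gset_act X) (gset_act Y) >].

Fact gset_rel_refl : reflexive gset_rel.
Proof. by move=> X; apply/asboolP/act_iso_refl. Qed.
Fact gset_rel_sym : symmetric gset_rel.
Proof. by move=> X Y; apply/asboolP/asboolP => /act_iso_sym. Qed.
Fact gset_rel_trans : transitive gset_rel.
Proof.
by move=> Y X Z /asboolP H /asboolP K; apply/asboolP; apply: act_iso_trans H K.
Qed.

Canonical gset_equiv :=
  EquivRel gset_rel gset_rel_refl gset_rel_sym gset_rel_trans.

Definition gset_class := {eq_quot gset_equiv}.
HB.instance Definition _ := Choice.on gset_class.
HB.instance Definition _ := EqQuotient.on gset_class.

Definition gcl (T : finType) (to : {action hT &-> T}) : gset_class :=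
  \pi_gset_class (GSet (ord_action to)).

Lemma eq_gcl (T1 T2 : finType) (to1 : {action hT &-> T1})
  (to2 : {action hT &-> T2}) : gcl to1 = gcl to2 <-> act_iso to1 to2.
Proof.
split=> [/eqP|H].
  rewrite /gcl eqmodE => /asboolP /= H.
  apply: act_iso_trans (ord_action_iso to1) _.
  exact: act_iso_trans H (act_iso_sym (ord_action_iso to2)).
apply/eqP; rewrite /gcl eqmodE; apply/asboolP => /=.
apply: act_iso_trans (act_iso_sym (ord_action_iso to1)) _.
exact: act_iso_trans H (ord_action_iso to2).
Qed.

Lemma gcl_gset (X : gset hT) : gcl (gset_act X) = \pi X.
Proof.
apply/eqP; rewrite /gcl eqmodE; apply/asboolP => /=.
exact/act_iso_sym/ord_action_iso.
Qed.

Lemma gcl_ind (P : gset_class -> Prop) :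
  (forall (T : finType) (to : {action hT &-> T}), P (gcl to)) -> forall x, P x.
Proof. by move=> H x; rewrite -[x]reprK -gcl_gset. Qed.

Lemma repr_gcl (T : finType) (to : {action hT &-> T}) :
  act_iso (gset_act (repr (gcl to))) to.
Proof. by apply/eq_gcl; rewrite gcl_gset reprK. Qed.

Definition gcl_add (x y : gset_class) : gset_class :=
  gcl (sum_action (gset_act (repr x)) (gset_act (repr y))).
Definition gcl_mul (x y : gset_class) : gset_class :=
  gcl (prod_action (gset_act (repr x)) (gset_act (repr y))).

End GSetClasses.

Section ActionIsos.

Variable hT : finGroupType.
Variables (T1 T2 T3 T1' T2' : finType).
Variables (to1 : {action hT &-> T1}) (to2 : {action hT &-> T2}).
Variables (to3 : {action hT &-> T3}).
Variables (to1' : {action hT &-> T1'}) (to2' : {action hT &-> T2'}).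

Lemma sum_iso : act_iso to1 to1' -> act_iso to2 to2' ->
  act_iso (sum_action to1 to2) (sum_action to1' to2').
Proof.
case=> f [f' fK f'K] fJ [g [g' gK g'K] gJ].
exists (fun u => match u with inl x => inl (f x) | inr y => inr (g y) end).
  exists (fun u => match u with inl x => inl (f' x) | inr y => inr (g' y) end);
  by case=> x; rewrite ?fK ?f'K ?gK ?g'K.
by case=> x a /=; rewrite ?fJ ?gJ.
Qed.

Lemma sumA_iso : act_iso (sum_action to1 (sum_action to2 to3))
                         (sum_action (sum_action to1 to2) to3).
Proof.
exists (fun u => match u with inl x => inl (inl x) | inr (inl y) => inl (inr y)
   | inr (inr z) => inr z end); last by move=> [x|[x|x]] a.
exists (fun u => match u with inl (inl x) => inl x | inl (inr y) => inr (inl y)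
   | inr z => inr (inr z) end); first by move=> [x|[x|x]].
by move=> [[x|x]|x].
Qed.

Lemma sumC_iso : act_iso (sum_action to1 to2) (sum_action to2 to1).
Proof.
exists (fun u => match u with inl x => inr x | inr y => inl y end).
  by exists (fun u => match u with inl x => inr x | inr y => inl y end); case.
by case.
Qed.

Lemma sum0_iso : act_iso (sum_action (void_action hT) to1) to1.
Proof.
exists (fun u => match u with inl x => match x : void with end | inr y => y end).
  by exists inr => [[[]|]|].
by case=> [[]|].
Qed.

Lemma prod_iso : act_iso to1 to1' -> act_iso to2 to2' ->
  act_iso (prod_action to1 to2) (prod_action to1' to2').
Proof.
case=> f [f' fK f'K] fJ [g [g' gK g'K] gJ].
exists (fun u => (f u.1, g u.2)).
  by exists (fun u => (f' u.1, g' u.2)); case=> x y /=; rewrite ?fK ?f'K ?gK ?g'K.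
by move=> u a /=; rewrite fJ gJ.
Qed.

Lemma prodA_iso : act_iso (prod_action to1 (prod_action to2 to3))
                          (prod_action (prod_action to1 to2) to3).
Proof.
exists (fun u => (u.1, u.2.1, u.2.2)) => //.
by exists (fun u => (u.1.1, (u.1.2, u.2))); [case=> [? []] | case=> [[]]].
Qed.

Lemma prodC_iso : act_iso (prod_action to1 to2) (prod_action to2 to1).
Proof.
by exists (fun u => (u.2, u.1)) => //; exists (fun u => (u.2, u.1)); case.
Qed.

Lemma prod1_iso : act_iso (prod_action (unit_action hT) to1) to1.
Proof.
exists (fun u => u.2) => //; exists (fun x => (tt, x)) => //.
by case=> [[]].
Qed.

Lemma prod0_iso : act_iso (prod_action (void_action hT) to1) (void_action hT).
Proof.
exists (fun u => u.1) => //.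
by exists (fun x => match x : void with end); case; case.
Qed.

Lemma prodDl_iso : act_iso (prod_action (sum_action to1 to2) to3)
  (sum_action (prod_action to1 to3) (prod_action to2 to3)).
Proof.
exists (fun u => match u.1 with inl x => inl (x, u.2) | inr y => inr (y, u.2) end).
  exists (fun u => match u with inl u => (inl u.1, u.2) | inr u => (inr u.1, u.2) end);
  by do 2![case].
by do 2!case.
Qed.

End ActionIsos.

Section GSetSemiring.

Variable hT : finGroupType.
Local Notation gset_class := (gset_class hT).

Lemma gcl_addE (T1 T2 : finType) (to1 : {action hT &-> T1})
    (to2 : {action hT &-> T2}) :
  gcl_add (gcl to1) (gcl to2) = gcl (sum_action to1 to2).
Proof. by apply/eq_gcl/sum_iso; apply: repr_gcl. Qed.

Lemma gcl_mulE (T1 T2 : finType) (to1 : {action hT &-> T1})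
    (to2 : {action hT &-> T2}) :
  gcl_mul (gcl to1) (gcl to2) = gcl (prod_action to1 to2).
Proof. by apply/eq_gcl/prod_iso; apply: repr_gcl. Qed.

Let gclE := (gcl_addE, gcl_mulE).

Fact gcl_addA : associative (@gcl_add hT).
Proof.
elim/gcl_ind=> T1 to1; elim/gcl_ind=> T2 to2; elim/gcl_ind=> T3 to3.
by rewrite !gclE; apply/eq_gcl/sumA_iso.
Qed.

Fact gcl_addC : commutative (@gcl_add hT).
Proof.
elim/gcl_ind=> T1 to1; elim/gcl_ind=> T2 to2.
by rewrite !gclE; apply/eq_gcl/sumC_iso.
Qed.

Fact gcl_add0 : left_id (gcl (void_action hT)) (@gcl_add hT).
Proof. by elim/gcl_ind=> T to; rewrite gclE; apply/eq_gcl/sum0_iso. Qed.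

HB.instance Definition _ :=
  GRing.isNmodule.Build gset_class gcl_addA gcl_addC gcl_add0.

Lemma gclD (T1 T2 : finType) (to1 : {action hT &-> T1})
    (to2 : {action hT &-> T2}) :
  gcl to1 + gcl to2 = gcl (sum_action to1 to2).
Proof. exact: gcl_addE. Qed.

Fact gcl_mulA : associative (@gcl_mul hT).
Proof.
elim/gcl_ind=> T1 to1; elim/gcl_ind=> T2 to2; elim/gcl_ind=> T3 to3.
by rewrite !gclE; apply/eq_gcl/prodA_iso.
Qed.

Fact gcl_mulC : commutative (@gcl_mul hT).
Proof.
elim/gcl_ind=> T1 to1; elim/gcl_ind=> T2 to2.
by rewrite !gclE; apply/eq_gcl/prodC_iso.
Qed.

Fact gcl_mul1 : left_id (gcl (unit_action hT)) (@gcl_mul hT).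
Proof. by elim/gcl_ind=> T to; rewrite gclE; apply/eq_gcl/prod1_iso. Qed.

Fact gcl_mul0 : left_zero (0 : gset_class) (@gcl_mul hT).
Proof. by elim/gcl_ind=> T to; rewrite gclE; apply/eq_gcl/prod0_iso. Qed.

Fact gcl_mulDl : left_distributive (@gcl_mul hT) +%R.
Proof.
elim/gcl_ind=> T1 to1; elim/gcl_ind=> T2 to2; elim/gcl_ind=> T3 to3.
rewrite !(gclD, gcl_mulE).
exact/eq_gcl/prodDl_iso.
Qed.

HB.instance Definition _ := GRing.Nmodule_isComPzSemiRing.Build gset_class
  gcl_mulA gcl_mulC gcl_mul1 gcl_mulDl gcl_mul0.

Lemma gclM (T1 T2 : finType) (to1 : {action hT &-> T1})
    (to2 : {action hT &-> T2}) :
  gcl to1 * gcl to2 = gcl (prod_action to1 to2).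
Proof. exact: gcl_mulE. Qed.

End GSetSemiring.

(* Units and inverses in an arbitrary ring, decided classically.              *)
Section ClassicalUnits.
Variable R : nzRingType.
Definition cunit (x : R) : bool := `[< exists y, y * x = 1 /\ x * y = 1 >].
Definition cinv (x : R) : R :=
  if pselect (exists y, y * x = 1 /\ x * y = 1) is left h then projT1 (cid h)
  else x.
Fact cmulVr : {in cunit, left_inverse 1 cinv *%R}.
Proof.
move=> x /asboolP h; rewrite /cinv; case: pselect => // h'.
by case: (cid h') => y [].
Qed.
Fact cmulrV : {in cunit, right_inverse 1 cinv *%R}.
Proof.
move=> x /asboolP h; rewrite /cinv; case: pselect => // h'.
by case: (cid h') => y [].
Qed.
Fact cunitP x y : y * x = 1 /\ x * y = 1 -> cunit x.
Proof. by move=> h; apply/asboolP; exists y. Qed.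
Fact cinv_out : {in [predC cunit], cinv =1 id}.
Proof.
by move=> x; rewrite !inE /cunit /cinv => /asboolPn h; case: pselect.
Qed.
End ClassicalUnits.

Section Burnside.

Variable hT : finGroupType.

Definition burnside := groth (gset_class hT).
HB.instance Definition _ := GRing.PzRing.on burnside.

HB.instance Definition _ :=
  GRing.PzRing_hasCommutativeMul.Build burnside (@groth_mulC (gset_class hT)).

Definition gdeg (x : gset_class hT) : int := (gset_card (repr x))%:Z.

Lemma gdeg_gcl (T : finType) (to : {action hT &-> T}) : gdeg (gcl to) = #|T|%:Z.
Proof.
by rewrite /gdeg; have [f /bij_eq_card + _] := repr_gcl to; rewrite card_ord => ->.
Qed.

Lemma gdegD : {morph gdeg : x y / x + y}.
Proof.
elim/gcl_ind=> T1 to1; elim/gcl_ind=> T2 to2.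
by rewrite gclD !gdeg_gcl card_sum PoszD.
Qed.

Fact burnside_neq0 : 1 != 0 :> burnside.
Proof.
apply/eqP => /(congr1 (groth_lift gdeg)).
rewrite -groth_of1 (groth_lift_of gdegD) -[0]/(groth_of 0) (groth_lift_of gdegD).
by rewrite !gdeg_gcl card_unit card_void.
Qed.

HB.instance Definition _ :=
  GRing.PzSemiRing_isNonZero.Build burnside burnside_neq0.
HB.instance Definition _ := GRing.NzRing_hasMulInverse.Build burnside
  (@cmulVr burnside) (@cmulrV burnside) (@cunitP burnside) (@cinv_out burnside).

Definition bclass (T : finType) (to : {action hT &-> T}) : burnside :=
  groth_of (gcl to).

Definition btrans (L : {group hT}) : burnside := bclass (coset_action L).

End Burnside.

(* (G, G)-bisets are left (G x G)-sets via (g, h) . x = g x h^-1; with the    *)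
(* encoding above, g x = to x (g^-1, 1) and x h = to x (1, h).                *)

Section Bisets.

Variable gT : finGroupType.
Local Notation gT2 := (gT * gT)%type.

Section Biset.
Variables (T : finType) (to : {action gT2 &-> T}).

Definition lmul (g : gT) (x : T) : T := to x (g^-1, 1)%g.
Definition rmul (x : T) (g : gT) : T := to x (1, g)%g.

Definition bifree : bool :=
  [forall x, forall g, (lmul g x == x) || (rmul x g == x) ==> (g == 1%g)].

Lemma bifreeP : reflect
  ((forall g x, lmul g x = x -> g = 1%g) /\ (forall g x, rmul x g = x -> g = 1%g))
  bifree.
Proof.
apply: (iffP idP) => [/forallP H|[H1 H2]].
  by split=> g x E; have /forallP/(_ g) := H x; rewrite E eqxx ?orbT => /eqP.
apply/forallP=> x; apply/forallP=> g; apply/implyP => /orP[]/eqP E; apply/eqP.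
  exact: H1 E.
exact: H2 E.
Qed.

Lemma lmul1 x : lmul 1%g x = x.
Proof. by rewrite /lmul invg1 act1. Qed.
Lemma rmul1 x : rmul x 1%g = x.
Proof. by rewrite /rmul act1. Qed.
Lemma lmulM g h x : lmul (g * h)%g x = lmul g (lmul h x).
Proof. by rewrite /lmul -actM invMg; congr (to x (_, _)); rewrite mulg1. Qed.
Lemma rmulM g h x : rmul x (g * h)%g = rmul (rmul x g) h.
Proof. by rewrite /rmul -actM; congr (to x (_, _)); rewrite mulg1. Qed.
Lemma lrmul g h x : lmul g (rmul x h) = rmul (lmul g x) h.
Proof. by rewrite /lmul /rmul -!actM; congr (to x (_, _)); rewrite ?mulg1 ?mul1g. Qed.
Lemma act_lrmul x c : to x c = lmul c.1^-1%g (rmul x c.2).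
Proof.
rewrite /lmul /rmul -actM; case: c => a b /=; congr (to x (_, _)).
  by rewrite mul1g invgK.
by rewrite mulg1.
Qed.
End Biset.

Lemma iso_bifree (T1 T2 : finType) (to1 : {action gT2 &-> T1})
  (to2 : {action gT2 &-> T2}) : act_iso to1 to2 -> bifree to1 -> bifree to2.
Proof.
case=> f [f' fK f'K] fJ /bifreeP[L R]; apply/bifreeP; split=> g x E.
  apply: (L g (f' x)); apply: (canRL fK); rewrite /lmul fJ f'K; exact: E.
apply: (R g (f' x)); apply: (canRL fK); rewrite /rmul fJ f'K; exact: E.
Qed.

Definition bset := {X : gset gT2 | bifree (gset_act X)}.
HB.instance Definition _ := Choice.on bset.

Definition bset_rel (X Y : bset) : bool := gset_rel (val X) (val Y).
Fact bset_rel_refl : reflexive bset_rel.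
Proof. by move=> X; apply: gset_rel_refl. Qed.
Fact bset_rel_sym : symmetric bset_rel.
Proof. by move=> X Y; apply: gset_rel_sym. Qed.
Fact bset_rel_trans : transitive bset_rel.
Proof. by move=> Y X Z; apply: gset_rel_trans. Qed.

Canonical bset_equiv :=
  EquivRel bset_rel bset_rel_refl bset_rel_sym bset_rel_trans.

Definition bset_class := {eq_quot bset_equiv}.
HB.instance Definition _ := Choice.on bset_class.
HB.instance Definition _ := EqQuotient.on bset_class.

Definition bcl (T : finType) (to : {action gT2 &-> T}) (fr : bifree to) :
    bset_class :=
  \pi_bset_class (exist (fun X : gset gT2 => bifree (gset_act X))
    (GSet (ord_action to)) (iso_bifree (ord_action_iso to) fr)).

Lemma eq_bcl (T1 T2 : finType) (to1 : {action gT2 &-> T1})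
    (to2 : {action gT2 &-> T2}) (fr1 : bifree to1) (fr2 : bifree to2) :
  bcl fr1 = bcl fr2 <-> act_iso to1 to2.
Proof.
split=> [/eqP|/eq_gcl/eqP]; rewrite /bcl /gcl !eqmodE => H.
  by apply/eq_gcl/eqP; rewrite /gcl eqmodE.
by apply/eqP; rewrite eqmodE.
Qed.

Lemma bcl_bset (X : bset) : bcl (valP X) = \pi X.
Proof.
apply/eqP; rewrite /bcl eqmodE; apply/asboolP => /=.
exact/act_iso_sym/ord_action_iso.
Qed.

Lemma bcl_ind (P : bset_class -> Prop) :
  (forall (T : finType) (to : {action gT2 &-> T}) (fr : bifree to), P (bcl fr)) ->
  forall x, P x.
Proof. by move=> H x; rewrite -[x]reprK -bcl_bset. Qed.

Lemma repr_bcl (T : finType) (to : {action gT2 &-> T}) (fr : bifree to) :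
  act_iso (gset_act (val (repr (bcl fr)))) to.
Proof. by apply/(eq_bcl (valP (repr (bcl fr))) fr); rewrite bcl_bset reprK. Qed.

Fact bifree_void : bifree (void_action gT2).
Proof. by apply/bifreeP; split=> g []. Qed.

Fact bifree_sum (T1 T2 : finType) (to1 : {action gT2 &-> T1})
    (to2 : {action gT2 &-> T2}) :
  bifree to1 -> bifree to2 -> bifree (sum_action to1 to2).
Proof.
move=> /bifreeP[L1 R1] /bifreeP[L2 R2]; apply/bifreeP.
by split=> g [x|x] [] => [/L1|/L2|/R1|/R2].
Qed.

Definition reg_act (x : gT) (c : gT2) : gT := (c.1^-1 * x * c.2)%g.
Fact reg_act1 : reg_act^~ 1%g =1 id.
Proof. by move=> x; rewrite /reg_act invg1 mul1g mulg1. Qed.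
Fact reg_actM x : act_morph reg_act x.
Proof. by move=> a b; rewrite /reg_act invMg !mulgA. Qed.
Definition reg_action := TotalAction reg_act1 reg_actM.

Fact bifree_reg : bifree reg_action.
Proof.
apply/bifreeP; split=> g x; rewrite /lmul /rmul /= /reg_act /=.
  by rewrite invgK mulg1 => /(canRL (mulgK _)); rewrite mulgV.
by rewrite invg1 mul1g => /(canRL (mulKg _)); rewrite mulVg.
Qed.

(* The tensor product of bisets is the set of orbits of X x Y under           *)
(* g . (x, y) = (x g^-1, g y); mid_act is the corresponding right action of   *)
(* k = g^-1, and (g, h) . [x, y] = [g x, y h^-1].                             *)
Section Tensor.
Variables (T1 T2 : finType).
Variables (to1 : {action gT2 &-> T1}) (to2 : {action gT2 &-> T2}).

Definition mid_act (u : T1 * T2) (k : gT) := (rmul to1 u.1 k, lmul to2 k^-1%g u.2).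
Fact mid_act1 : mid_act^~ 1%g =1 id.
Proof. by case=> x y; rewrite /mid_act rmul1 invg1 lmul1. Qed.
Fact mid_actM u : act_morph mid_act u.
Proof. by move=> a b; rewrite /mid_act rmulM invMg lmulM. Qed.
Definition mid_action := TotalAction mid_act1 mid_actM.

Definition tens_type := {A : {set T1 * T2} |
  A \in [set orbit mid_action [set: gT] u | u : T1 * T2]}.

Definition tens_map (c : gT2) (u : T1 * T2) :=
  (lmul to1 c.1^-1%g u.1, rmul to2 u.2 c.2).

Fact tens_mapJ c u k : tens_map c (mid_act u k) = mid_act (tens_map c u) k.
Proof. by rewrite /tens_map /mid_act /= !lrmul. Qed.

Fact tens_map_orbit c u : tens_map c @: orbit mid_action [set: gT] u
  = orbit mid_action [set: gT] (tens_map c u).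
Proof.
apply/setP=> v; apply/imsetP/orbitP => [[_ /orbitP[k _ <-] ->]|[k _ <-]].
  by exists k => //; rewrite /= tens_mapJ.
by exists (mid_act u k); [apply/orbitP; exists k | rewrite tens_mapJ].
Qed.

Fact tens_act_proof (A : tens_type) c : tens_map c @: val A
  \in [set orbit mid_action [set: gT] u | u : T1 * T2].
Proof.
case: A => A /= /imsetP[u _ ->]; rewrite tens_map_orbit.
exact: imset_f.
Qed.

Definition tens_act (A : tens_type) c : tens_type :=
  Sub (tens_map c @: val A) (tens_act_proof A c).
Fact tens_act1 : tens_act^~ 1%g =1 id.
Proof.
move=> A; apply: val_inj => /=; rewrite -[RHS]imset_id; apply: eq_imset => u.
by rewrite /tens_map invg1 lmul1 rmul1 -surjective_pairing.
Qed.
Fact tens_actM A : act_morph tens_act A.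
Proof.
move=> a b; apply: val_inj => /=; rewrite -imset_comp; apply: eq_imset => u.
by rewrite /tens_map /= invMg lmulM rmulM.
Qed.
Definition tens_action := TotalAction tens_act1 tens_actM.

Fact tpair_proof (u : T1 * T2) : orbit mid_action [set: gT] u
  \in [set orbit mid_action [set: gT] u | u : T1 * T2].
Proof. exact: imset_f. Qed.
Definition tpair (u : T1 * T2) : tens_type :=
  Sub (orbit mid_action [set: gT] u) (tpair_proof u).

Lemma tpair_surj A : exists u, tpair u = A.
Proof.
by case: A => A HA; have /imsetP[u _ E] := HA; exists u; apply: val_inj.
Qed.

Lemma eq_tpair u v : tpair u = tpair v <->
  exists2 k, v.1 = rmul to1 u.1 k & v.2 = lmul to2 k^-1%g u.2.
Proof.
split=> [/(congr1 val)/= E|[k]].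
  by have := orbit_refl mid_action [set: gT] v; rewrite -E => /orbitP[k _ <-]; exists k.
case: v => x y /= -> ->; apply: val_inj => /=; apply/esym/orbit_act_in; first exact: subxx.
by rewrite inE.
Qed.

Lemma tpairJ u c :
  tens_act (tpair u) c = tpair (lmul to1 c.1^-1%g u.1, rmul to2 u.2 c.2).
Proof. by apply: val_inj; rewrite /= tens_map_orbit. Qed.

Lemma lmul_tpair g u :
  lmul tens_action g (tpair u) = tpair (lmul to1 g u.1, u.2).
Proof. by rewrite /lmul /= tpairJ /= /lmul invgK rmul1. Qed.

Lemma rmul_tpair g u :
  rmul tens_action (tpair u) g = tpair (u.1, rmul to2 u.2 g).
Proof. by rewrite /rmul /= tpairJ /= invg1 lmul1. Qed.

Fact bifree_tens : bifree to1 -> bifree to2 -> bifree tens_action.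
Proof.
move=> /bifreeP[L1 R1] /bifreeP[L2 R2]; apply/bifreeP; split=> g A.
  have [[x y] <-] := tpair_surj A; rewrite /lmul /= tpairJ /= invgK rmul1.
  move=> /esym/eq_tpair[k /= E1 /esym/L2 /eqP].
  by rewrite eq_invg1 => /eqP k1; move: E1; rewrite k1 rmul1; apply: L1.
have [[x y] <-] := tpair_surj A; rewrite /rmul /= tpairJ /= invg1 lmul1.
move=> /esym/eq_tpair[k /= /esym/R1 -> E2].
by move: E2; rewrite invg1 lmul1; apply: R2.
Qed.

End Tensor.

Arguments lmul : simpl never.
Arguments rmul : simpl never.
Arguments tpair : simpl never.
Arguments tens_act : simpl never.

Section TensorIsos.
Variables (T1 T2 T3 T1' T2' : finType).
Variables (to1 : {action gT2 &-> T1}) (to2 : {action gT2 &-> T2}).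
Variables (to3 : {action gT2 &-> T3}).
Variables (to1' : {action gT2 &-> T1'}) (to2' : {action gT2 &-> T2'}).

Lemma tens_iso : act_iso to1 to1' -> act_iso to2 to2' ->
  act_iso (tens_action to1 to2) (tens_action to1' to2').
Proof.
case=> f [f' fK f'K] fJ [g [g' gK g'K] gJ].
apply: (act_iso_surj (p := tpair to1 to2)
  (q := fun u => tpair to1' to2' (f u.1, g u.2))).
- exact: tpair_surj.
- move=> B; have [[x y] <-] := tpair_surj B; exists (f' x, g' y) => /=.
  by rewrite f'K g'K.
- move=> [x y] [x' y']; rewrite !eq_tpair /=.
  split=> -[k E1 E2]; exists k.
  - by rewrite E1 /rmul fJ.
  - by rewrite E2 /lmul gJ.
  - by apply: (can_inj fK); rewrite E1 /rmul fJ.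
  by apply: (can_inj gK); rewrite E2 /lmul gJ.
move=> u c; exists (lmul to1 c.1^-1%g u.1, rmul to2 u.2 c.2).
  by rewrite /= tpairJ.
by rewrite /= tpairJ /= /lmul /rmul fJ gJ.
Qed.

Lemma tensA_iso : act_iso (tens_action to1 (tens_action to2 to3))
                          (tens_action (tens_action to1 to2) to3).
Proof.
apply: (act_iso_surj
  (p := fun u => tpair to1 (tens_action to2 to3) (u.1.1, tpair to2 to3 (u.1.2, u.2)))
  (q := fun u => tpair (tens_action to1 to2) to3 (tpair to1 to2 u.1, u.2))).
- move=> A; have [[x B] <-] := tpair_surj A; have [[y z] <-] := tpair_surj B.
  by exists (x, y, z).
- move=> A; have [[B z] <-] := tpair_surj A; have [[x y] <-] := tpair_surj B.
  by exists (x, y, z).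
- move=> [[x y] z] [[x' y'] z']; rewrite !eq_tpair /=; split.
    move=> [k ->]; rewrite lmul_tpair /= => /esym/eq_tpair /= [l -> ->].
    exists l => //; rewrite rmul_tpair /=.
    by apply/esym/eq_tpair; exists k; rewrite /= ?lrmul.
  move=> [l]; rewrite rmul_tpair /= => /esym/eq_tpair /= [k -> ->] ->.
  exists k => //; rewrite lmul_tpair /=.
  by apply/esym/eq_tpair; exists l; rewrite /= ?lrmul.
move=> [[x y] z] c; exists (lmul to1 c.1^-1%g x, y, rmul to3 z c.2) => /=.
  by rewrite tpairJ /= rmul_tpair.
by rewrite tpairJ /= lmul_tpair.
Qed.

Lemma tens1l_iso : act_iso (tens_action reg_action to1) to1.
Proof.
apply: (act_iso_surj (p := fun x => tpair reg_action to1 (1%g, x)) (q := id)).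
- move=> A; have [[g x] <-] := tpair_surj A; exists (lmul to1 g x).
  apply/eq_tpair; exists g; rewrite /=; first by rewrite /rmul /= /reg_act /= invg1 !mul1g.
  by rewrite -lmulM mulVg lmul1.
- by move=> x; exists x.
- move=> x y; split=> [/eq_tpair/= [k + ->]|-> //].
  by rewrite /rmul /= /reg_act /= invg1 !mul1g => <-; rewrite invg1 lmul1.
move=> x c; exists (to1 x c) => //=; rewrite tpairJ; apply/eq_tpair.
exists c.1^-1%g; rewrite /= ?act_lrmul; last by rewrite -lmulM mulVg lmul1.
by rewrite /lmul /rmul /= /reg_act /= !invgK invg1 !mulg1 mul1g.
Qed.

Lemma tens1r_iso : act_iso (tens_action to1 reg_action) to1.
Proof.
apply: (act_iso_surj (p := fun x => tpair to1 reg_action (x, 1%g)) (q := id)).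
- move=> A; have [[x g] <-] := tpair_surj A; exists (rmul to1 x g).
  apply/eq_tpair; exists g^-1%g; rewrite /=; first by rewrite -rmulM mulgV rmul1.
  by rewrite invgK /lmul /= /reg_act /= invgK !mulg1.
- by move=> x; exists x.
- move=> x y; split=> [/eq_tpair/= [k ->]|-> //].
  rewrite /lmul /= /reg_act /= invgK !mulg1 => /esym/eqP.
  by rewrite eq_invg1 => /eqP ->; rewrite rmul1.
move=> x c; exists (to1 x c) => //=; rewrite tpairJ; apply/eq_tpair.
exists c.2^-1%g; rewrite /= ?act_lrmul ?lrmul; first by rewrite -rmulM mulgV rmul1.
by rewrite /lmul /rmul /= /reg_act /= invg1 !invgK !mul1g !mulg1.
Qed.

Lemma tens0l_iso : act_iso (tens_action (void_action gT2) to1) (void_action gT2).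
Proof.
apply: (act_iso_surj (p := fun u : void * T1 => tpair (void_action gT2) to1 u)
  (q := fun u => u.1)); try by case.
exact: tpair_surj.
Qed.

Lemma tens0r_iso : act_iso (tens_action to1 (void_action gT2)) (void_action gT2).
Proof.
apply: (act_iso_surj (p := fun u : T1 * void => tpair to1 (void_action gT2) u)
  (q := fun u => u.2)); try by [case | case=> ? []].
exact: tpair_surj.
Qed.

Lemma tensDl_iso : act_iso (tens_action (sum_action to1 to2) to3)
  (sum_action (tens_action to1 to3) (tens_action to2 to3)).
Proof.
apply: (act_iso_surj (p := fun u => tpair (sum_action to1 to2) to3 u)
  (q := fun u => match u.1 with inl x => inl (tpair to1 to3 (x, u.2))
                              | inr y => inr (tpair to2 to3 (y, u.2)) end)).
- exact: tpair_surj.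
- case=> A; have [[x z] <-] := tpair_surj A.
    by exists (inl x, z).
  by exists (inr x, z).
- move=> [x z] [x' z']; rewrite eq_tpair /=; split.
    move=> [k -> ->]; case: x => x; rewrite /rmul /=.
      by congr inl; apply/eq_tpair; exists k.
    by congr inr; apply/eq_tpair; exists k.
  case: x x' => x [] x' // [] E.
    have /eq_tpair/=[k -> ->] : tpair to1 to3 (x, z) = tpair to1 to3 (x', z') by apply: val_inj; exact: E.
    by exists k.
  have /eq_tpair/=[k -> ->] : tpair to2 to3 (x, z) = tpair to2 to3 (x', z') by apply: val_inj; exact: E.
  by exists k.
move=> [x z] c; exists (lmul (sum_action to1 to2) c.1^-1%g x, rmul to3 z c.2).
  by rewrite /= tpairJ.
by case: x => x /=; rewrite tpairJ.
Qed.

Lemma tensDr_iso : act_iso (tens_action to3 (sum_action to1 to2))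
  (sum_action (tens_action to3 to1) (tens_action to3 to2)).
Proof.
apply: (act_iso_surj (p := fun u => tpair to3 (sum_action to1 to2) u)
  (q := fun u => match u.2 with inl x => inl (tpair to3 to1 (u.1, x))
                              | inr y => inr (tpair to3 to2 (u.1, y)) end)).
- exact: tpair_surj.
- case=> A; have [[z x] <-] := tpair_surj A.
    by exists (z, inl x).
  by exists (z, inr x).
- move=> [z x] [z' x']; rewrite eq_tpair /=; split.
    move=> [k -> ->]; case: x => x; rewrite /lmul /=.
      by congr inl; apply/eq_tpair; exists k.
    by congr inr; apply/eq_tpair; exists k.
  case: x x' => x [] x' // [] E.
    have /eq_tpair/=[k -> ->] : tpair to3 to1 (z, x) = tpair to3 to1 (z', x') by apply: val_inj; exact: E.
    by exists k.
  have /eq_tpair/=[k -> ->] : tpair to3 to2 (z, x) = tpair to3 to2 (z', x') by apply: val_inj; exact: E.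
  by exists k.
move=> [z x] c; exists (lmul to3 c.1^-1%g z, rmul (sum_action to1 to2) x c.2).
  by rewrite /= tpairJ.
by case: x => x /=; rewrite tpairJ.
Qed.

End TensorIsos.

Definition bcl_add (x y : bset_class) : bset_class :=
  bcl (bifree_sum (valP (repr x)) (valP (repr y))).
Definition bcl_mul (x y : bset_class) : bset_class :=
  bcl (bifree_tens (valP (repr x)) (valP (repr y))).

Lemma bcl_addE (T1 T2 : finType) (to1 : {action gT2 &-> T1})
    (to2 : {action gT2 &-> T2}) (fr1 : bifree to1) (fr2 : bifree to2) :
  bcl_add (bcl fr1) (bcl fr2) = bcl (bifree_sum fr1 fr2).
Proof. by apply/eq_bcl/sum_iso; apply: repr_bcl. Qed.

Lemma bcl_mulE (T1 T2 : finType) (to1 : {action gT2 &-> T1})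
    (to2 : {action gT2 &-> T2}) (fr1 : bifree to1) (fr2 : bifree to2) :
  bcl_mul (bcl fr1) (bcl fr2) = bcl (bifree_tens fr1 fr2).
Proof. by apply/eq_bcl/tens_iso; apply: repr_bcl. Qed.

Let bclE := (bcl_addE, bcl_mulE).

Fact bcl_addA : associative bcl_add.
Proof.
elim/bcl_ind=> T1 to1 fr1; elim/bcl_ind=> T2 to2 fr2; elim/bcl_ind=> T3 to3 fr3.
by rewrite !bclE; apply/eq_bcl/sumA_iso.
Qed.

Fact bcl_addC : commutative bcl_add.
Proof.
elim/bcl_ind=> T1 to1 fr1; elim/bcl_ind=> T2 to2 fr2.
by rewrite !bclE; apply/eq_bcl/sumC_iso.
Qed.

Fact bcl_add0 : left_id (bcl bifree_void) bcl_add.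
Proof. by elim/bcl_ind=> T to fr; rewrite bclE; apply/eq_bcl/sum0_iso. Qed.

HB.instance Definition _ :=
  GRing.isNmodule.Build bset_class bcl_addA bcl_addC bcl_add0.

Lemma bclD (T1 T2 : finType) (to1 : {action gT2 &-> T1})
    (to2 : {action gT2 &-> T2}) (fr1 : bifree to1) (fr2 : bifree to2) :
  bcl fr1 + bcl fr2 = bcl (bifree_sum fr1 fr2).
Proof. exact: bcl_addE. Qed.

Fact bcl_mulA : associative bcl_mul.
Proof.
elim/bcl_ind=> T1 to1 fr1; elim/bcl_ind=> T2 to2 fr2; elim/bcl_ind=> T3 to3 fr3.
by rewrite !bclE; apply/eq_bcl/tensA_iso.
Qed.

Fact bcl_mul1 : left_id (bcl bifree_reg) bcl_mul.
Proof. by elim/bcl_ind=> T to fr; rewrite bclE; apply/eq_bcl/tens1l_iso. Qed.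

Fact bcl_mulr1 : right_id (bcl bifree_reg) bcl_mul.
Proof. by elim/bcl_ind=> T to fr; rewrite bclE; apply/eq_bcl/tens1r_iso. Qed.

Fact bcl_mulDl : left_distributive bcl_mul +%R.
Proof.
elim/bcl_ind=> T1 to1 fr1; elim/bcl_ind=> T2 to2 fr2; elim/bcl_ind=> T3 to3 fr3.
by rewrite !(bclD, bcl_mulE); apply/eq_bcl/tensDl_iso.
Qed.

Fact bcl_mulDr : right_distributive bcl_mul +%R.
Proof.
elim/bcl_ind=> T3 to3 fr3; elim/bcl_ind=> T1 to1 fr1; elim/bcl_ind=> T2 to2 fr2.
by rewrite !(bclD, bcl_mulE); apply/eq_bcl/tensDr_iso.
Qed.

Fact bcl_mul0 : left_zero (0 : bset_class) bcl_mul.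
Proof. by elim/bcl_ind=> T to fr; rewrite bcl_mulE; apply/eq_bcl/tens0l_iso. Qed.

Fact bcl_mulr0 : right_zero (0 : bset_class) bcl_mul.
Proof. by elim/bcl_ind=> T to fr; rewrite bcl_mulE; apply/eq_bcl/tens0r_iso. Qed.

HB.instance Definition _ := GRing.Nmodule_isPzSemiRing.Build bset_class
  bcl_mulA bcl_mul1 bcl_mulr1 bcl_mulDl bcl_mulDr bcl_mul0 bcl_mulr0.

Lemma bclM (T1 T2 : finType) (to1 : {action gT2 &-> T1})
    (to2 : {action gT2 &-> T2}) (fr1 : bifree to1) (fr2 : bifree to2) :
  bcl fr1 * bcl fr2 = bcl (bifree_tens fr1 fr2).
Proof. exact: bcl_mulE. Qed.

(* B^Delta(G, G); its product x * y is x ._G y.                               *)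
Definition bburnside := groth bset_class.
HB.instance Definition _ := GRing.PzRing.on bburnside.

Definition bdeg (x : bset_class) : int := (gset_card (val (repr x)))%:Z.

Lemma bdeg_bcl (T : finType) (to : {action gT2 &-> T}) (fr : bifree to) :
  bdeg (bcl fr) = #|T|%:Z.
Proof.
by rewrite /bdeg; have [f /bij_eq_card + _] := repr_bcl fr; rewrite card_ord => ->.
Qed.

Lemma bdegD : {morph bdeg : x y / x + y}.
Proof.
elim/bcl_ind=> T1 to1 fr1; elim/bcl_ind=> T2 to2 fr2.
by rewrite bclD !bdeg_bcl card_sum PoszD.
Qed.

Fact bburnside_neq0 : 1 != 0 :> bburnside.
Proof.
apply/eqP => /(congr1 (groth_lift bdeg)).
rewrite -groth_of1 (groth_lift_of bdegD) -[0]/(groth_of 0) (groth_lift_of bdegD).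
rewrite !bdeg_bcl card_void => -[E]; have := max_card (pred1 (1%g : gT)).
by rewrite E card1.
Qed.

HB.instance Definition _ :=
  GRing.PzSemiRing_isNonZero.Build bburnside bburnside_neq0.
HB.instance Definition _ := GRing.NzRing_hasMulInverse.Build bburnside
  (@cmulVr bburnside) (@cmulrV bburnside) (@cunitP bburnside) (@cinv_out bburnside).

Definition bbclass (T : finType) (to : {action gT2 &-> T}) (fr : bifree to) :
  bburnside := groth_of (bcl fr).

End Bisets.

(* The group law of Aut(G) is composition, (f * g) x = f (g x), which is      *)
(* opposite to the product of {perm gT}.                                      *)

Section Automorphisms.

Variable gT : finGroupType.

Definition autG := {s : {perm gT} | s \in Aut [set: gT]}.
HB.instance Definition _ := Finite.on autG.

Definition autG_fun (f : autG) : gT -> gT := val f.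
Coercion autG_fun : autG >-> Funclass.

Fact autG_mul_proof (f g : autG) : (val g * val f)%g \in Aut [set: gT].
Proof. by rewrite groupM ?(valP f) ?(valP g). Qed.
Fact autG_inv_proof (f : autG) : (val f)^-1%g \in Aut [set: gT].
Proof. by rewrite groupV (valP f). Qed.

Definition autG_mul (f g : autG) : autG := Sub (val g * val f)%g (autG_mul_proof f g).
Definition autG_one : autG := Sub 1%g (group1 _).
Definition autG_inv (f : autG) : autG := Sub (val f)^-1%g (autG_inv_proof f).

Fact autG_mulA : associative autG_mul.
Proof. by move=> f g h; apply: val_inj; rewrite /= mulgA. Qed.
Fact autG_mul1 : left_id autG_one autG_mul.
Proof. by move=> f; apply: val_inj; rewrite /= mulg1. Qed.
Fact autG_mulV : left_inverse autG_one autG_inv autG_mul.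
Proof. by move=> f; apply: val_inj; rewrite /= mulgV. Qed.

HB.instance Definition _ :=
  Finite_isGroup.Build autG autG_mulA autG_mul1 autG_mulV.

Lemma autGM (f g : autG) x : autG_fun (f * g)%g x = f (g x).
Proof. exact: permM. Qed.
Lemma autG1 x : autG_fun 1%g x = x.
Proof. exact: perm1. Qed.
Lemma autGP (f g : autG) : (forall x, f x = g x) -> f = g.
Proof. by move=> E; apply: val_inj; apply/permP. Qed.

Definition autGm (f : autG) : {morphism [set: gT] >-> gT} :=
  autm_morphism (valP f).

Lemma autGmE (f : autG) x : autGm f x = f x.
Proof. by []. Qed.

Lemma autG_morphM (f : autG) : {morph f : x y / (x * y)%g}.
Proof. by move=> x y; rewrite -!autGmE morphM ?inE. Qed.

Lemma autG_inj (f : autG) : injective f.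
Proof. exact: perm_inj. Qed.

Definition Inn : {set autG} :=
  [set f : autG | [exists g : gT, forall x, f x == (g * x * g^-1)%g]].

Lemma InnP (f : autG) :
  reflect (exists g, forall x, f x = g * x * g^-1)%g (f \in Inn).
Proof.
rewrite inE; apply: (iffP existsP) => -[g E]; exists g.
  by move=> x; apply/eqP; move/forallP: E.
by apply/forallP=> x; rewrite E.
Qed.

Fact Inn_group_set : group_set Inn.
Proof.
apply/group_setP; split.
  by apply/InnP; exists 1%g => x; rewrite autG1 mul1g invg1 mulg1.
move=> f h /InnP[a Ea] /InnP[b Eb]; apply/InnP; exists (a * b)%g => x.
by rewrite autGM Eb Ea invMg !mulgA.
Qed.
Canonical Inn_group := Group Inn_group_set.

Lemma Inn_norm : (Inn <| [set: autG])%g.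
Proof.
apply/andP; split; first exact: subsetT.
apply/subsetP=> f _; rewrite inE; apply/subsetP=> _ /imsetP[h /InnP[a Ea] ->].
apply/InnP; exists (autG_fun f^-1%g a) => x; rewrite /conjg !autGM Ea !autG_morphM.
have fK y : autG_fun f^-1%g (autG_fun f y) = y by rewrite -autGM mulVg autG1.
rewrite fK; congr (_ * _)%g; apply: (mulgI (autG_fun f^-1%g a)).
rewrite -autG_morphM !mulgV; apply: (mulgI (autG_fun f^-1%g 1%g)).
by rewrite -autG_morphM !mulg1.
Qed.

Definition Out := coset_of Inn.
HB.instance Definition _ := FinGroup.on Out.

Definition outc (f : autG) : Out := coset Inn f.
Definition out_repr (w : Out) : autG := fingroup.repr (w : {set autG}).

Lemma outcM : {morph outc : f g / (f * g)%g}.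
Proof.
move=> f g; have /andP[_ /subsetP nI] := Inn_norm.
by rewrite /outc morphM ?nI ?inE.
Qed.

Lemma out_reprK : cancel out_repr outc.
Proof. by move=> w; rewrite /outc /out_repr coset_reprK. Qed.

Lemma eq_outc (f g : autG) :
  outc f = outc g <-> exists a, forall x, f x = (a * g x * a^-1)%g.
Proof.
have nI h : h \in 'N(Inn)%g.
  by have /andP[_ /subsetP] := Inn_norm; apply; rewrite inE.
split=> [E|[a E]].
  have : (f * g^-1)%g \in Inn.
    rewrite -[Inn]/(gval Inn_group); apply: coset_idr; first exact: nI.
    rewrite morphM ?groupV ?nI // morphV ?nI //.
    by apply/eqP; rewrite -eq_mulgV1; apply/eqP; exact: E.
  case/InnP=> a Ea; exists a => x; rewrite -Ea autGM.
  by rewrite -[autG_fun g^-1%g (g x)]autGM mulVg autG1.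
have /InnP I : exists a, forall x, autG_fun (f * g^-1)%g x = (a * x * a^-1)%g.
  exists a => x; rewrite autGM E; congr (_ * _ * _)%g.
  by rewrite -autGM mulgV autG1.
rewrite -[f](mulgKV g) outcM /outc (coset_id I) mul1g //.
Qed.

End Automorphisms.

Section GroupRing.

Variable oT : finGroupType.

Definition zring := {ffun oT -> int}.
HB.instance Definition _ := GRing.Zmodule.on zring.

Definition zmul (a b : zring) : zring :=
  [ffun g => \sum_h a h * b (h^-1 * g)%g].

Definition zelt (g : oT) : zring := [ffun h => (h == g)%:R].

Fact zmulA : associative zmul.
Proof.
move=> a b c; apply/ffunP=> g; rewrite !ffunE.
under eq_bigr => h _ do rewrite ffunE big_distrr /=.
under [RHS]eq_bigr => h _ do rewrite ffunE big_distrl /=.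
rewrite [RHS]exchange_big /=; apply: eq_bigr => h _.
rewrite [RHS](reindex_inj (mulgI h)) /=; apply: eq_bigr => k _.
by rewrite mulKg invMg mulrA -mulgA.
Qed.

Fact zmul1 : left_id (zelt 1%g) zmul.
Proof.
move=> a; apply/ffunP=> g; rewrite ffunE (bigD1 1%g) //= ffunE eqxx mul1r.
rewrite invg1 mul1g big1 ?addr0 // => h /negPf h1.
by rewrite ffunE h1 mul0r.
Qed.

Fact zmulr1 : right_id (zelt 1%g) zmul.
Proof.
move=> a; apply/ffunP=> g; rewrite ffunE (bigD1 g) //= ffunE mulVg eqxx mulr1.
rewrite big1 ?addr0 // => h hg; rewrite ffunE -eq_mulVg1.
by rewrite (negPf hg) mulr0.
Qed.

Fact zmulDl : left_distributive zmul +%R.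
Proof.
move=> a b c; apply/ffunP=> g; rewrite !ffunE -big_split /=.
by apply: eq_bigr => h _; rewrite ffunE mulrDl.
Qed.

Fact zmulDr : right_distributive zmul +%R.
Proof.
move=> a b c; apply/ffunP=> g; rewrite !ffunE -big_split /=.
by apply: eq_bigr => h _; rewrite ffunE mulrDr.
Qed.

Fact zone_neq0 : zelt 1%g != 0.
Proof. by apply/eqP=> /ffunP/(_ 1%g)/eqP; rewrite !ffunE eqxx. Qed.

HB.instance Definition _ := GRing.Zmodule_isNzRing.Build zring
  zmulA zmul1 zmulr1 zmulDl zmulDr zone_neq0.

Lemma zeltM g h : zelt (g * h)%g = zelt g * zelt h.
Proof.
apply/ffunP=> k; rewrite !ffunE (bigD1 g) //= !ffunE eqxx mul1r.
rewrite big1 ?addr0; last by move=> l /negPf lg; rewrite ffunE lg mul0r.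
by rewrite -(inj_eq (mulgI g^-1%g)) mulKg.
Qed.

End GroupRing.

(* Linear extension: orb_ext f X is the sum of f(stabiliser) over the orbits  *)
(* of X, so that orb_ext f (H/L) = f L when f is constant on conjugacy        *)
(* classes of subgroups.                                                      *)
Section OrbitExtension.

Variables (hT : finGroupType) (V : zmodType) (f : {group hT} -> V).

Definition orbits (T : finType) (to : {action hT &-> T}) : {set {set T}} :=
  orbit to [set: hT] @: [set: T].

Definition orb_val (T : finType) (to : {action hT &-> T}) (O : {set T}) : V :=
  if [pick x in O] is Some x then f 'C[x | to]%G else 0.

Definition orb_ext (T : finType) (to : {action hT &-> T}) : V :=
  \sum_(O in orbits to) orb_val to O.

Hypothesis fJ : forall L a, f (L :^ a)%G = f L.

Lemma orb_valE (T : finType) (to : {action hT &-> T}) x :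
  orb_val to (orbit to [set: hT] x) = f 'C[x | to]%G.
Proof.
rewrite /orb_val; case: pickP => [y /orbitP[a _ <-]|/(_ x)]; last first.
  by rewrite orbit_refl.
rewrite -[RHS](fJ _ a); congr f; apply: val_inj; exact: astab1_act.
Qed.

Lemma orb_ext_inj (T1 T2 : finType) (to1 : {action hT &-> T1})
    (to2 : {action hT &-> T2}) (h : T1 -> T2) :
    injective h -> (forall x a, h (to1 x a) = to2 (h x) a) ->
  \sum_(O in [set h @: (O : {set T1}) | O in orbits to1]) orb_val to2 O
    = orb_ext to1.
Proof.
move=> h_inj hJ; rewrite big_imset /=; last by move=> A B _ _; apply: imset_inj.
apply: eq_bigr => _ /imsetP[x _ ->].
have -> : h @: orbit to1 [set: hT] x = orbit to2 [set: hT] (h x).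
  apply/setP=> y; apply/imsetP/orbitP => [[_ /orbitP[a _ <-] ->]|[a _ <-]].
    by exists a.
  by exists (to1 x a); [apply/orbitP; exists a | rewrite hJ].
rewrite !orb_valE; congr f; apply/val_inj/setP=> a /=.
apply/astab1P/astab1P; last by rewrite -hJ => ->.
by rewrite -hJ => /h_inj.
Qed.

Lemma orb_ext_iso (T1 T2 : finType) (to1 : {action hT &-> T1})
  (to2 : {action hT &-> T2}) : act_iso to1 to2 -> orb_ext to1 = orb_ext to2.
Proof.
case=> h [h' hK h'K] hJ; rewrite -(orb_ext_inj (can_inj hK) hJ) /orb_ext.
apply: eq_bigl => O; apply/imsetP/imsetP => [[_ /imsetP[x _ ->] ->]|[y _ ->]].
  exists (h x) => //; apply/setP=> y; apply/imsetP/orbitP.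
    by case=> _ /orbitP[a _ <-] ->; exists a.
  by case=> a _ <-; exists (to1 x a); [apply/orbitP; exists a | rewrite hJ].
exists (orbit to1 [set: hT] (h' y)); first exact: imset_f.
apply/setP=> z; apply/orbitP/imsetP => [[a _ <-]|[_ /orbitP[a _ <-] ->]].
  by exists (to1 (h' y) a); [apply/orbitP; exists a | rewrite hJ h'K].
by exists a; rewrite // hJ h'K.
Qed.

Lemma orb_ext_sum (T1 T2 : finType) (to1 : {action hT &-> T1})
    (to2 : {action hT &-> T2}) :
  orb_ext (sum_action to1 to2) = orb_ext to1 + orb_ext to2.
Proof.
have inl_inj : injective (@inl T1 T2) by move=> x y [].
have inr_inj : injective (@inr T1 T2) by move=> x y [].
rewrite -(orb_ext_inj (to2 := sum_action to1 to2) inl_inj) //.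
rewrite -(orb_ext_inj (to2 := sum_action to1 to2) inr_inj) //.
have orbl x : orbit (sum_action to1 to2) [set: hT] (inl x)
    = inl @: orbit to1 [set: hT] x.
  apply/setP=> y; apply/orbitP/imsetP => [[a _ <-]|[_ /orbitP[a _ <-] ->]].
    by exists (to1 x a) => //; apply/orbitP; exists a.
  by exists a.
have orbr x : orbit (sum_action to1 to2) [set: hT] (inr x)
    = inr @: orbit to2 [set: hT] x.
  apply/setP=> y; apply/orbitP/imsetP => [[a _ <-]|[_ /orbitP[a _ <-] ->]].
    by exists (to2 x a) => //; apply/orbitP; exists a.
  by exists a.
rewrite -bigU /=; last first.
  rewrite -setI_eq0; apply/eqP/setP=> O; rewrite !inE; apply/negP.
  case/andP=> /imsetP[_ /imsetP[x _ ->] ->] /imsetP[_ /imsetP[y _ ->]].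
  move/setP/(_ (inl x)); rewrite imset_f ?orbit_refl // => /esym/imsetP.
  by case.
apply: eq_bigl => O; rewrite inE; apply/imsetP/orP.
  case=> [[x|y] _ ->]; [left; rewrite orbl|right; rewrite orbr];
  by apply: imset_f; apply: imset_f.
case=> /imsetP[_ /imsetP[x _ ->] ->].
  by exists (inl x) => //; rewrite orbl.
by exists (inr x) => //; rewrite orbr.
Qed.

Lemma orb_ext_coset (L : {group hT}) : orb_ext (coset_action L) = f L.
Proof.
have tr (A : coset_type L) : orbit (coset_action L) [set: hT] A
    = orbit (coset_action L) [set: hT] (coset_base L).
  apply/orbit_eqP; case: A => A HA; have /lcosetsP[x _ E] := HA.
  apply/orbitP; exists x^-1%g => //; apply: val_inj => /=.
  by rewrite invgK E.
rewrite /orb_ext (_ : orbits _ = [set orbit (coset_action L) [set: hT] (coset_base L)]).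
  rewrite big_set1 orb_valE; congr f; apply/val_inj/setP=> a /=.
  apply/astab1P/idP => [/(congr1 val)/= E|La].
    by rewrite -groupV; have := lcoset_refl L a^-1%g; rewrite E.
  by apply: val_inj => /=; rewrite lcoset_id ?groupV.
apply/setP=> O; rewrite inE; apply/imsetP/eqP => [[A _ ->]|->]; first exact: tr.
by exists (coset_base L).
Qed.

End OrbitExtension.

Lemma coset_actionJ (hT : finGroupType) (L : {group hT}) a :
  act_iso (coset_action (L :^ a)%G) (coset_action L).
Proof.
have E x : val (coset_action (L :^ a)%G (coset_base _) (a^-1 * x)%g)
    = (val (coset_action L (coset_base _) x) :* a)%g.
  by rewrite /= conjsgE invMg invgK -lcosetM mulgK mulgA.
apply: (act_iso_surj
  (p := fun x => coset_action (L :^ a)%G (coset_base _) (a^-1 * x)%g)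
  (q := fun x => coset_action L (coset_base _) x)).
- case=> A HA; have /lcosetsP[x _ Ex] := HA; exists (a * x^-1)%g.
  by apply: val_inj; rewrite /= mulKg invgK Ex.
- case=> A HA; have /lcosetsP[x _ Ex] := HA; exists (x^-1)%g.
  by apply: val_inj; rewrite /= invgK Ex.
- move=> x y; split=> /(congr1 val) Exy; apply: val_inj.
    by apply: (can_inj (rcosetK a)); rewrite -!E Exy.
  by rewrite !E Exy.
by move=> x b; exists (x * b)%g; rewrite -actM ?mulgA.
Qed.

(* burn_ext f is the additive map on B(H) with [H/L] |-> f L, and bburn_ext f *)
(* the additive map on B^Delta(G, G) with [(G x G)/L] |-> f L.                *)

Section Extensions.

Variable V : zmodType.

Section Burn.
Variables (hT : finGroupType) (f : {group hT} -> V).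

Definition burn_ext : burnside hT -> V :=
  groth_lift (fun c : gset_class hT => orb_ext f (gset_act (repr c))).

Hypothesis fJ : forall L a, f (L :^ a)%G = f L.

Fact burn_ext_gclD :
  {morph (fun c : gset_class hT => orb_ext f (gset_act (repr c))) : c d / c + d}.
Proof.
elim/gcl_ind=> T1 to1; elim/gcl_ind=> T2 to2 /=.
by rewrite gclD !(orb_ext_iso fJ (repr_gcl _)) orb_ext_sum.
Qed.

Lemma burn_extD : {morph burn_ext : x y / x + y}.
Proof. exact: groth_liftD burn_ext_gclD. Qed.

Lemma burn_ext_class (T : finType) (to : {action hT &-> T}) :
  burn_ext (bclass to) = orb_ext f to.
Proof.
by rewrite /burn_ext (groth_lift_of burn_ext_gclD) (orb_ext_iso fJ (repr_gcl _)).
Qed.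

Lemma burn_ext_trans L : burn_ext (btrans L) = f L.
Proof. by rewrite burn_ext_class orb_ext_coset. Qed.
End Burn.

Section Bburn.
Variables (gT : finGroupType) (f : {group gT * gT} -> V).

Definition bburn_ext : bburnside gT -> V :=
  groth_lift (fun c : bset_class gT => orb_ext f (gset_act (val (repr c)))).

Hypothesis fJ : forall L a, f (L :^ a)%G = f L.

Fact bburn_ext_bclD :
  {morph (fun c : bset_class gT => orb_ext f (gset_act (val (repr c)))) : c d / c + d}.
Proof.
elim/bcl_ind=> T1 to1 fr1; elim/bcl_ind=> T2 to2 fr2 /=.
by rewrite bclD !(orb_ext_iso fJ (repr_bcl _)) orb_ext_sum.
Qed.

Lemma bburn_extD : {morph bburn_ext : x y / x + y}.
Proof. exact: groth_liftD bburn_ext_bclD. Qed.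

Lemma bburn_ext_class (T : finType) (to : {action gT * gT &-> T}) (fr : bifree to) :
  bburn_ext (bbclass fr) = orb_ext f to.
Proof.
by rewrite /bburn_ext (groth_lift_of bburn_ext_bclD) (orb_ext_iso fJ (repr_bcl _)).
Qed.
End Bburn.

End Extensions.

Section Maps.

Variable gT : finGroupType.
Local Notation gT2 := (gT * gT)%type.
Local Notation B := (burnside gT).
Local Notation BD := (bburnside gT).
Local Notation Out := (Out gT).

(* [(G x G)/L]; the value 0 is taken only if L is not a twisted diagonal      *)
(* subgroup, since (G x G)/L is then not bifree.                              *)
Definition bbtrans (L : {group gT2}) : BD :=
  if boolP (bifree (coset_action L)) is AltTrue fr then bbclass fr else 0.

Lemma bbtransE L (fr : bifree (coset_action L)) : bbtrans L = bbclass fr.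
Proof.
rewrite /bbtrans; case: {-}_ / boolP => [fr'|]; last by rewrite fr.
by rewrite (bool_irrelevance fr' fr).
Qed.

Lemma bbtransJ L a : bbtrans (L :^ a)%G = bbtrans L.
Proof.
have iso := coset_actionJ L a; rewrite {2}/bbtrans; case: {-}_ / boolP => fr.
  rewrite (bbtransE (iso_bifree (act_iso_sym iso) fr)).
  by congr groth_of; apply/eq_bcl.
rewrite /bbtrans; case: {-}_ / boolP => // fr'.
by case/negP: fr; apply: iso_bifree iso fr'.
Qed.

Lemma btransJ (L : {group gT}) a : btrans (L :^ a)%G = btrans L.
Proof. by congr groth_of; apply/eq_gcl/coset_actionJ. Qed.

Lemma bburn_ext_trans (V : zmodType) (f : {group gT2} -> V) L :
  (forall L a, f (L :^ a)%G = f L) -> bifree (coset_action L) ->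
  bburn_ext f (bbtrans L) = f L.
Proof. by move=> fJ fr; rewrite (bbtransE fr) bburn_ext_class ?orb_ext_coset. Qed.

(* Delta(R, alpha, S) with R = alpha(S); alpha is meant to be injective.      *)
Section TwistedDiagonal.
Variables (S : {group gT}) (alpha : {morphism S >-> gT}).
Definition tdiag_set : {set gT2} := [set (alpha s, s) | s in S].
Fact tdiag_group_set : group_set tdiag_set.
Proof.
apply/group_setP; split; first by apply/imsetP; exists 1%g; rewrite ?morph1.
move=> _ _ /imsetP[s Ss ->] /imsetP[t St ->]; apply/imsetP.
by exists (s * t)%g; rewrite ?groupM // morphM.
Qed.
Definition tdiag : {group gT2} := Group tdiag_group_set.

Lemma bifree_tdiag : ('injm alpha)%g -> bifree (coset_action tdiag).
Proof.
move=> inj; apply/bifreeP.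
have key c A : coset_action tdiag A c = A ->
    exists2 x : gT2, True & (x^-1 * c * x)%g \in tdiag.
  case: A => A HA /(congr1 val)/= E; have /lcosetsP[x _ EA] := HA.
  exists x => //; move: E; rewrite EA -lcosetM => /lcoset_eqP.
  by rewrite mem_lcoset -groupV !invMg !invgK.
split=> g A /key [[x y] _] /imsetP[s Ss] [].
  rewrite mulg1 mulVg => E1 E2; move: E1; rewrite -E2 morph1.
  by move=> /(canRL (mulgK _))/(canRL (mulKg _)); rewrite mul1g invgK mulgV => /eqP; rewrite eq_invg1 => /eqP.
rewrite mulg1 mulVg => /esym E1 E2.
have s1 : s = 1%g.
  by apply/eqP; rewrite -(morph_injm_eq1 inj Ss); apply/eqP.
by move: E2; rewrite s1 => /(canRL (mulgK _))/(canRL (mulKg _)); rewrite mul1g invgK mulgV.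
Qed.
End TwistedDiagonal.

Definition diag_group (R : {group gT}) : {group gT2} := tdiag (idm_morphism R).
Definition autdiag (phi : autG gT) : {group gT2} := tdiag (autGm phi).

Lemma bifree_diag R : bifree (coset_action (diag_group R)).
Proof. exact/bifree_tdiag/injm_idm. Qed.
Lemma bifree_autdiag phi : bifree (coset_action (autdiag phi)).
Proof. exact/bifree_tdiag/injm_autm. Qed.

Lemma mem_diag R c : (c \in diag_group R) = (c.1 == c.2) && (c.2 \in R).
Proof.
apply/imsetP/andP => [[s Rs ->] //|[/eqP E R2]].
by case: c E R2 => x y /= -> Ry; exists y.
Qed.

Lemma mem_autdiag phi c : (c \in autdiag phi) = (c.1 == phi c.2).
Proof.
apply/imsetP/eqP => [[s _ ->] //|E].
by case: c E => x y /= ->; exists y; rewrite ?inE.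
Qed.

Section Opposite.
Variable L : {group gT2}.
Definition swap_set : {set gT2} := [set (c.2, c.1) | c in L].
Fact swap_group_set : group_set swap_set.
Proof.
apply/group_setP; split; first by apply/imsetP; exists 1%g.
move=> _ _ /imsetP[c Lc ->] /imsetP[d Ld ->]; apply/imsetP.
by exists (c * d)%g; rewrite ?groupM.
Qed.
Definition swap_group : {group gT2} := Group swap_group_set.

Lemma mem_swap c : (c \in swap_group) = ((c.2, c.1) \in L).
Proof.
apply/imsetP/idP => [[[a b] Lc ->] //|H].
by exists (c.2, c.1) => //; case: c H.
Qed.
End Opposite.

Definition iotaB : B -> BD := burn_ext (fun R => bbtrans (diag_group R)).

(* out_repr picks a representative phi of each class; the choice is immaterial *)
(* (autdiag_outc, out_act_trans).                                             *)
Definition etaB (a : zring Out) : BD :=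
  \sum_(w : Out) bbtrans (autdiag (out_repr w)) *~ a w.

Definition rhoB : BD -> zring Out := bburn_ext (fun L =>
  if [pick phi : autG gT | L == autdiag phi] is Some phi then zelt (outc phi)
  else 0).

Definition bop : BD -> BD := bburn_ext (fun L => bbtrans (swap_group L)).

Definition out_act (w : Out) : B -> B :=
  burn_ext (fun R => btrans (autGm (out_repr w) @* R)%G).

Lemma diagJ (R : {group gT}) a : (diag_group (R :^ a) = diag_group R :^ (a, a))%G.
Proof.
apply/val_inj/setP=> -[x y]; rewrite /= mem_conjg !mem_diag /=.
by rewrite mem_conjg (inj_eq (conjg_inj _)).
Qed.

Lemma autdiagJ phi c : exists2 psi, outc psi = outc phi &
  (autdiag phi :^ c = autdiag psi)%G.
Proof.
case: c => a b.
pose i g : gT -> gT := fun x => (g * x * g^-1)%g.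
have inn g : exists k : autG gT, forall x, k x = (g * x * g^-1)%g.
  have ij : injective (i g) by move=> x y /mulIg/mulgI.
  have kA : perm ij \in Aut [set: gT].
    rewrite inE; apply/andP; split; first by apply/subsetP=> x _; rewrite inE.
    apply/morphicP=> x y _ _; rewrite !permE /i !mulgA.
    by rewrite mulgKV.
  by exists (Sub (perm ij) kA) => x; rewrite /autG_fun /= permE.
have [k Ek] := inn (a^-1 * phi b)%g.
exists (k * phi)%g.
  apply/eq_outc; exists (a^-1 * phi b)%g => x.
  by rewrite -Ek -autGM.
apply/val_inj/setP=> -[x y]; rewrite /= mem_conjg !mem_autdiag /= autGM Ek.
have phiV : phi b^-1%g = (phi b)^-1%g by rewrite -autGmE morphV ?inE.
rewrite !autG_morphM !invgK phiV invMg invgK.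
apply/eqP/eqP => [E|->]; last by rewrite !mulgA mulgV mul1g mulgK.
have -> : x = (a^-1 * (a * (x * a^-1)) * a)%g by rewrite mulKg mulgKV.
by rewrite E !mulgA.
Qed.

Lemma autdiag_inj (phi psi : autG gT) : autdiag phi = autdiag psi -> phi = psi.
Proof.
move=> E; apply: autGP => x; apply/eqP.
by rewrite -[phi x]/(phi x, x).1 -(mem_autdiag psi) -E mem_autdiag.
Qed.

Fact iotaJ (R : {group gT}) a : bbtrans (diag_group (R :^ a)%G) = bbtrans (diag_group R).
Proof. by rewrite diagJ bbtransJ. Qed.

Lemma iotaBD : {morph iotaB : x y / x + y}.
Proof. exact: burn_extD iotaJ. Qed.

Lemma iota_trans R : iotaB (btrans R) = bbtrans (diag_group R).
Proof. exact: burn_ext_trans iotaJ R. Qed.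

Lemma autdiag_outc phi psi : outc phi = outc psi ->
  bbtrans (autdiag phi) = bbtrans (autdiag psi).
Proof.
case/eq_outc=> a E; rewrite -[RHS](bbtransJ _ (a^-1, 1)%g); congr bbtrans.
apply/val_inj/setP=> -[x y]; rewrite /= mem_conjg !mem_autdiag /= E.
rewrite !invgK invg1 mul1g mulg1.
apply/eqP/eqP => [->|<-]; first by rewrite !mulgA mulVg mul1g mulgKV.
by rewrite !mulgA mulgV mul1g mulgK.
Qed.

Lemma eta_elt phi : etaB (zelt (outc phi)) = bbtrans (autdiag phi).
Proof.
rewrite /etaB (bigD1 (outc phi)) //= ffunE eqxx mulr1z big1 ?addr0.
  by apply: autdiag_outc; rewrite out_reprK.
by move=> w /negPf ww; rewrite ffunE ww mulr0z.
Qed.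

Fact rhoJ (L : {group gT2}) c :
  (if [pick phi : autG gT | (L :^ c)%G == autdiag phi] is Some phi
   then zelt (outc phi) else 0)
  = (if [pick phi : autG gT | L == autdiag phi] is Some phi
     then zelt (outc phi) else 0).
Proof.
case: pickP => [phi /eqP E|no]; case: pickP => [psi /eqP F|no'] //.
- have [chi <- EF] := autdiagJ psi c; congr (zelt (outc _)).
  by apply: autdiag_inj; rewrite -E -EF F.
- have [chi _ EF] := autdiagJ phi c^-1%g; have /eqP[] := no' chi.
  by rewrite -EF -E; apply: val_inj; rewrite /= conjsgK.
by have [chi _ EF] := autdiagJ psi c; have /eqP[] := no chi; rewrite F.
Qed.

Lemma rhoBD : {morph rhoB : x y / x + y}.
Proof. exact: bburn_extD rhoJ. Qed.

Lemma rho_autdiag phi : rhoB (bbtrans (autdiag phi)) = zelt (outc phi).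
Proof.
rewrite /rhoB (bburn_ext_trans rhoJ (bifree_autdiag phi)).
case: pickP => [psi /eqP/autdiag_inj -> //|/(_ phi)].
by rewrite eqxx.
Qed.

Lemma rho_tdiag0 (S : {group gT}) (alpha : {morphism S >-> gT}) :
  ('injm alpha)%g -> S != [set: gT] :> {set gT} -> rhoB (bbtrans (tdiag alpha)) = 0.
Proof.
move=> inj ST; rewrite /rhoB (bburn_ext_trans rhoJ (bifree_tdiag inj)).
case: pickP => // psi /eqP E; case/eqP: ST; apply/setP=> x; rewrite inE.
have : (autG_fun psi x, x) \in autdiag psi by rewrite mem_autdiag.
by rewrite -E => /imsetP[s Ss [_ ->]].
Qed.

Fact bopJ (L : {group gT2}) c :
  bbtrans (swap_group (L :^ c)%G) = bbtrans (swap_group L).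
Proof.
rewrite -[RHS](bbtransJ _ (c.2, c.1)); congr bbtrans.
by apply/val_inj/setP=> -[x y]; rewrite /= mem_conjg !mem_swap /= mem_conjg.
Qed.

Lemma bopD : {morph bop : x y / x + y}.
Proof. exact: bburn_extD bopJ. Qed.

Lemma bop_tdiag (S : {group gT}) (alpha : {morphism S >-> gT}) :
  ('injm alpha)%g -> bop (bbtrans (tdiag alpha)) = bbtrans (swap_group (tdiag alpha)).
Proof. by move=> inj; apply/(bburn_ext_trans bopJ)/bifree_tdiag. Qed.

Fact out_actJ (phi : autG gT) (R : {group gT}) a :
  btrans (autGm phi @* (R :^ a))%G = btrans (autGm phi @* R)%G.
Proof.
rewrite -[RHS](btransJ _ (phi a)); congr btrans; apply: val_inj.
by rewrite /= morphimJ ?inE.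
Qed.

Lemma out_actD w : {morph out_act w : x y / x + y}.
Proof. exact: burn_extD (out_actJ _). Qed.

Lemma out_act_trans phi R :
  out_act (outc phi) (btrans R) = btrans (autGm phi @* R)%G.
Proof.
rewrite /out_act (burn_ext_trans (out_actJ _)).
have /eq_outc[a E] : outc (out_repr (outc phi)) = outc phi by rewrite out_reprK.
rewrite -[RHS](btransJ _ a^-1%g); congr btrans; apply/val_inj/setP=> x /=.
rewrite mem_conjg invgK; apply/morphimP/idP => [[y _ Ry ->]|].
  apply/morphimP; exists y => //; rewrite !autGmE E conjgE !mulgA mulVg mul1g.
  by rewrite mulgKV.
case/morphimP=> y _ Ry Exy; exists y => //; rewrite autGmE E -[phi y]autGmE -Exy.
by rewrite conjgE !mulgA mulgV mul1g mulgK.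
Qed.

Lemma bbtrans1 : bbtrans (diag_group [set: gT]%G) = 1.
Proof.
rewrite (bbtransE (bifree_diag _)) -groth_of1; congr groth_of; apply/eq_bcl.
apply: (act_iso_surj
  (p := fun c => coset_action (diag_group [set: gT]%G) (coset_base _) c)
  (q := fun c => reg_action gT 1%g c)).
- case=> A HA; have /lcosetsP[c _ E] := HA; exists c^-1%g.
  by apply: val_inj; rewrite /= invgK E.
- by move=> x; exists (1, x)%g; rewrite /= /reg_act /= invg1 !mul1g.
- move=> c d; have cE : coset_action (diag_group [set: gT]%G) (coset_base _) c =
      coset_action (diag_group [set: gT]%G) (coset_base _) d <->
      (d * c^-1)%g \in diag_group [set: gT]%G.
    split=> [/(congr1 val) E|H].
      have /lcoset_eqP : (c^-1 *: diag_group [set: gT] = d^-1 *: diag_group [set: gT])%g := E.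
      by rewrite mem_lcoset invgK.
    by apply: val_inj; apply/lcoset_eqP; rewrite mem_lcoset invgK.
  rewrite cE mem_diag inE andbT; case: c d {cE} => [a b] [x y] /=.
  rewrite /reg_act /= !mulg1; split=> [/eqP/(canRL (mulgKV _)) ->|E].
    by rewrite !invMg invgK -!mulgA mulVg mulg1.
  by apply/eqP; rewrite -[y](mulKVg x) -E !mulgA mulgK.
by move=> c d; exists (c * d)%g; rewrite actM.
Qed.

End Maps.

From mathcomp Require Import classical_sets.

Local Open Scope classical_set_scope.

Section UnitSubgroups.

Variable R : unitRingType.
Implicit Types A H K N : set R.

Definition unit_group A : Prop :=
  [/\ A `<=` [set x | x \is a GRing.unit], A 1,
      forall x y, A x -> A y -> A (x * y) & forall x, A x -> A x^-1].

Definition subgroup_of K H : Prop :=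
  [/\ unit_group K, unit_group H & K `<=` H].

Definition normal_in N H : Prop :=
  subgroup_of N H /\ forall n h, N n -> H h -> N (h * n * h^-1).

(* H is the (internal) semidirect product of N and K.                         *)
Definition semidirect H N K : Prop :=
  [/\ normal_in N H, subgroup_of K H, N `&` K = [set 1] &
      H = [set x * y | x in N & y in K]].

End UnitSubgroups.

Definition burn_units (gT : finGroupType) : set (burnside gT) :=
  [set u | u \is a GRing.unit].

Definition orth_units (gT : finGroupType) : set (bburnside gT) :=
  [set x | x * bop x = 1 /\ bop x * x = 1].

Definition eta_out (gT : finGroupType) (w : Out gT) : bburnside gT :=
  etaB (zelt w).

Definition is_sign (e : int) : Prop := e = 1 \/ e = -1.

(* The w with rhoB x = w or rhoB x = - w; 1 is a default value.               *)
Definition opi (gT : finGroupType) (x : bburnside gT) : Out gT :=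
  odflt 1%g [pick w | (rhoB x == zelt w) || (rhoB x == - zelt w)].

(* Main.v *)
Require Import Defs.
From mathcomp Require Import all_boot all_order all_algebra all_fingroup.
From mathcomp Require Import generic_quotient boolp ring.

Set Implicit Arguments.
Unset Strict Implicit.
Unset Printing Implicit Defensive.

Import GRing.Theory Num.Theory.
Local Open Scope ring_scope.

(** Everything is read off from marks, that is, numbers of fixed points.  By
Burnside's theorem two finite sets with a group action are isomorphic as soon
as all their marks agree ([marks_iso]), so that elements of B(G) and of
B^Delta(G,G) are determined by their marks ([gmark_inj], [bmark_inj]).

For a bifree biset X and families alpha, beta of elements of G, let
m(X; alpha, beta) be the number of x in X with alpha_i x = x beta_i for all i.
If a point [x, y] of X (x)_G Y satisfies alpha_i [x, y] = [x, y] gamma_i, then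
there are unique beta_i with alpha_i x = x beta_i and beta_i y = y gamma_i.
Counting pairs gives the product formula ([bmarkM])
  |G| m(XY; alpha, gamma) = sum_beta m(X; alpha, beta) m(Y; beta, gamma):
up to the factor |G|, marks form a matrix representation of B^Delta(G,G).  The
anti-involution transposes these matrices, and the matrices of iota(u), of
eta(phi) and of 1 are explicit ([iota_bmark], [autdiag_bmark], [bmark1E]).  So
all identities between iota, eta and the anti-involution that are needed,
including (e), are comparisons of marks.

Let x be an orthogonal unit and write c(alpha) for the order of the
centraliser of alpha.  Orthogonality says that the squares in row alpha add
up to |G| c(alpha).  Since c(alpha) and c(beta) both divide m(alpha, beta),
and since m is constant on the |G| / c(beta) conjugates of beta, one nonzero
entry already exhausts the sum: up to conjugation, each row and each column
has a single nonzero entry, and its square is c(alpha) c(beta) ([orth_row],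
[orth_col]).  The remaining claims follow from this rigidity.
- The coefficients of rho(x) are marks at automorphisms divided by |Z(G)|
  ([rho_bmark]).  Hence exactly one of them is nonzero, and it is a sign; that
  pi is multiplicative follows by composing nonzero entries ([orth_comp]).
- If m(x iota(u) x^o; alpha, delta) is nonzero, then some column beta of x has
  nonzero entries at both alpha and delta, so these are conjugate
  ([iota_conj]).  An element whose marks vanish at all pairs that are not
  conjugate lies in iota(B(G)) ([diag_marks_iota]), which gives normality.
- Units u of B(G) have marks 1 and -1, so u^2 = 1; as iota(u) is fixed by the
  anti-involution, iota(u) is orthogonal exactly when u^2 = 1 ([orth_iota]).
The semidirect product decomposition is then formal, since eta splits pi. *)

(** * Orbit decomposition of finite group actions *)

Section OrbitDecomposition.

Variable hT : finGroupType.
Implicit Types (T : finType) (L : {group hT}).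

Lemma act_eqE T (to : {action hT &-> T}) x a b :
  (to x a = to x b) <-> ((b * a^-1)%g \in 'C[x | to]%g).
Proof.
split=> [E|/astab1P E]; last by rewrite -[in LHS]E -actM mulgKV.
by apply/astab1P; rewrite actM -E -actM mulgV act1.
Qed.

Lemma coset_base_eqE L a b :
  (coset_action L (coset_base L) a = coset_action L (coset_base L) b) <->
  ((b * a^-1)%g \in L).
Proof.
split=> [/(congr1 val) E|H].
  have /lcoset_eqP : (a^-1 *: L = b^-1 *: L)%g := E.
  by rewrite mem_lcoset invgK.
by apply: val_inj; apply/lcoset_eqP; rewrite mem_lcoset invgK.
Qed.

Lemma coset_base_tr L A : exists a, coset_action L (coset_base L) a = A.
Proof.
case: A => A HA; have /lcosetsP[x _ E] := HA; exists x^-1%g.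
by apply: val_inj; rewrite /= invgK E.
Qed.

Lemma coset_base_stab L : 'C[coset_base L | coset_action L]%g = L.
Proof.
apply/setP=> a; rewrite -[a in RHS]mulg1 -[1%g in RHS]invg1.
apply/astab1P/idP => [E|/coset_base_eqE].
  by apply/coset_base_eqE; rewrite act1 E.
by rewrite act1.
Qed.

Lemma coset_iso T (to : {action hT &-> T}) x L :
    (forall y, exists a, to x a = y) -> 'C[x | to]%g = L ->
  act_iso (coset_action L) to.
Proof.
move=> tr st; apply: (act_iso_surj
  (p := coset_action L (coset_base L)) (q := to x)) => //.
- exact: coset_base_tr.
- by move=> a b; rewrite coset_base_eqE act_eqE st.
by move=> a b; exists (a * b)%g; rewrite actM.
Qed.

Section Split.
Variables (T : finType) (to : {action hT &-> T}) (x : T).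
Let T' := {y : T | y \notin orbit to [set: hT] x}.

Fact split_act_proof (y : T') a : to (val y) a \notin orbit to [set: hT] x.
Proof.
apply: contra (valP y) => /orbitP[b _ E]; apply/orbitP.
by exists (b * a^-1)%g; rewrite ?inE // actM E actK.
Qed.
Definition split_act (y : T') a : T' := Sub (to (val y) a) (split_act_proof y a).
Fact split_act1 : split_act^~ 1%g =1 id.
Proof. by move=> y; apply: val_inj; rewrite /= act1. Qed.
Fact split_actM y : act_morph split_act y.
Proof. by move=> a b; apply: val_inj; rewrite /= actM. Qed.
Definition split_action := TotalAction split_act1 split_actM.

Lemma orbit_split_iso :
  act_iso (sum_action (coset_action 'C[x | to]%G) split_action) to.
Proof.
set L := 'C[x | to]%G.
have inlI : injective (@inl (coset_type L) T') by move=> A B [].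
have inrI : injective (@inr (coset_type L) T') by move=> A B [].
apply: (act_iso_surj
  (p := fun u : hT + T' => match u with
        | inl a => inl (coset_action L (coset_base L) a) | inr y => inr y end)
  (q := fun u : hT + T' => match u with inl a => to x a | inr y => val y end)).
- case=> [A|y]; last by exists (inr y).
  by have [a <-] := coset_base_tr A; exists (inl a).
- move=> y; have [/orbitP[a _ <-]|ny] := boolP (y \in orbit to [set: hT] x).
    by exists (inl a).
  by exists (inr (Sub y ny)).
- move=> [a|y] [b|z]; split=> //.
  + by move=> /inlI/coset_base_eqE H; apply/act_eqE.
  + by move=> /act_eqE H; congr inl; apply/coset_base_eqE.
  + by move=> E; case/negP: (valP z); rewrite -E mem_orbit ?inE.
  + by move=> E; case/negP: (valP y); rewrite E mem_orbit ?inE.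
  + by move=> /inrI ->.
  by move/val_inj=> ->.
move=> [a|y] b; last by exists (inr (split_act y b)).
exists (inl (a * b)%g); last exact: actM.
by rewrite actM.
Qed.

Lemma split_lt : (#|{: T'}| < #|T|)%N.
Proof.
rewrite card_sig; apply/proper_card/properP.
by split; [exact: subset_predT | exists x; rewrite // inE /= orbit_refl].
Qed.

End Split.

Lemma orbit_split T (to : {action hT &-> T}) x :
  exists (T' : finType) (to' : {action hT &-> T'}), (#|T'| < #|T|)%N /\
    act_iso (sum_action (coset_action 'C[x | to]%G) to') to.
Proof.
by exists {y : T | y \notin orbit to [set: hT] x}, (split_action to x);
  split; [exact: split_lt | exact: orbit_split_iso].
Qed.

Lemma void_iso T (to : {action hT &-> T}) :
  #|T| = 0%N -> act_iso (void_action hT) to.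
Proof.
move=> T0; have no (x : T) : False by have := fintype0 x T0.
exists (fun v : void => match v with end); last by case.
by exists (fun x => match no x with end) => [[]|x]; case: (no x).
Qed.

(** Since every orbit is isomorphic to a coset space, statements that are
invariant under isomorphism can be proved by adding one transitive set at a
time. *)
Lemma action_ind (P : forall T : finType, {action hT &-> T} -> Prop) :
    (forall (T1 T2 : finType) (to1 : {action hT &-> T1}) (to2 : {action hT &-> T2}),
      act_iso to1 to2 -> P T1 to1 -> P T2 to2) ->
    P void (void_action hT) ->
    (forall L (T : finType) (to : {action hT &-> T}),
      P T to -> P _ (sum_action (coset_action L) to)) ->
  forall (T : finType) (to : {action hT &-> T}), P T to.
Proof.
move=> Piso P0 PS T; have [n le_Tn] := ubnP #|T|.
elim: n T le_Tn => // n IHn T le_Tn to.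
have [x _|T0] := pickP (pred_of_simpl (@predT T)); last first.
  by apply: Piso P0; apply/void_iso/eq_card0.
have [T' [to' [lt_T' iso]]] := orbit_split to x.
by apply: Piso iso (PS _ _ _ (IHn _ _ _)); apply: leq_trans lt_T' le_Tn.
Qed.

End OrbitDecomposition.

(** * Additive maps on the two Grothendieck groups *)

Lemma morphDB (U V : zmodType) (f : U -> V) :
  {morph f : x y / x + y} -> {morph f : x y / x - y}.
Proof. by move=> fD x y; apply/eqP; rewrite eq_sym subr_eq -fD subrK. Qed.

Lemma morphD0 (U V : zmodType) (f : U -> V) :
  {morph f : x y / x + y} -> f 0 = 0.
Proof. by move=> /morphDB fB; rewrite -(subrr 0) fB subrr. Qed.

Section Generation.

Variable hT : finGroupType.

Lemma bclass_sum (T1 T2 : finType) (to1 : {action hT &-> T1})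
    (to2 : {action hT &-> T2}) :
  bclass (sum_action to1 to2) = bclass to1 + bclass to2.
Proof. by rewrite /bclass -gclD groth_ofD. Qed.

Lemma bclass_iso (T1 T2 : finType) (to1 : {action hT &-> T1})
  (to2 : {action hT &-> T2}) : act_iso to1 to2 -> bclass to1 = bclass to2.
Proof. by move=> iso; congr groth_of; apply/eq_gcl. Qed.

Lemma burn_ind (P : burnside hT -> Prop) :
    (forall (T : finType) (to : {action hT &-> T}), P (bclass to)) ->
    (forall x y, P x -> P y -> P (x - y)) ->
  forall x, P x.
Proof.
move=> PC PB; elim/groth_ind=> a b; rewrite gpairE.
by elim/gcl_ind: a => T1 to1; elim/gcl_ind: b => T2 to2; apply: PB; apply: PC.
Qed.

(** The transitive sets span B(H), so an identity between additive maps need only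
be checked on them. *)
Lemma burn_eq (V : zmodType) (f g : burnside hT -> V) :
    {morph f : x y / x + y} -> {morph g : x y / x + y} ->
    (forall L, f (btrans L) = g (btrans L)) ->
  f =1 g.
Proof.
move=> fD gD fg; apply: burn_ind => [|x y Ex Ey]; last first.
  by rewrite (morphDB fD) (morphDB gD) Ex Ey.
apply: (@action_ind hT (fun T to => f (bclass to) = g (bclass to))).
- by move=> T1 T2 to1 to2 /bclass_iso ->.
- by rewrite -[bclass _]/(0 : burnside hT) (morphD0 fD) (morphD0 gD).
by move=> L T to E; rewrite bclass_sum fD gD E -[bclass _]/(btrans L) fg.
Qed.

End Generation.

Section BisetGeneration.

Variable gT : finGroupType.
Local Notation gT2 := (gT * gT)%type.

Lemma bifree_sumP (T1 T2 : finType) (to1 : {action gT2 &-> T1})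
    (to2 : {action gT2 &-> T2}) :
  bifree (sum_action to1 to2) -> bifree to1 /\ bifree to2.
Proof.
move=> /bifreeP[Fl Fr].
split; apply/bifreeP; split=> g x E.
- by apply: (Fl g (inl x)); congr inl.
- by apply: (Fr g (inl x)); congr inl.
- by apply: (Fl g (inr x)); congr inr.
by apply: (Fr g (inr x)); congr inr.
Qed.

Lemma bbclass_sum (T1 T2 : finType) (to1 : {action gT2 &-> T1})
    (to2 : {action gT2 &-> T2}) (fr1 : bifree to1) (fr2 : bifree to2)
    (fr : bifree (sum_action to1 to2)) :
  bbclass fr = bbclass fr1 + bbclass fr2.
Proof.
rewrite /bbclass -groth_ofD bclD; congr groth_of; apply/eq_bcl.
exact: act_iso_refl.
Qed.

Lemma bbclass_iso (T1 T2 : finType) (to1 : {action gT2 &-> T1})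
    (to2 : {action gT2 &-> T2}) (fr1 : bifree to1) (fr2 : bifree to2) :
  act_iso to1 to2 -> bbclass fr1 = bbclass fr2.
Proof. by move=> iso; congr groth_of; apply/eq_bcl. Qed.

Lemma bburn_ind (P : bburnside gT -> Prop) :
    (forall (T : finType) (to : {action gT2 &-> T}) (fr : bifree to),
       P (bbclass fr)) ->
    (forall x y, P x -> P y -> P (x - y)) ->
  forall x, P x.
Proof.
move=> PC PB; elim/groth_ind=> a b; rewrite gpairE.
by elim/bcl_ind: a => T1 to1 fr1; elim/bcl_ind: b => T2 to2 fr2; apply: PB; apply: PC.
Qed.

Lemma bburn_eq (V : zmodType) (f g : bburnside gT -> V) :
    {morph f : x y / x + y} -> {morph g : x y / x + y} ->
    (forall L (fr : bifree (coset_action L)), f (bbclass fr) = g (bbclass fr)) ->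
  f =1 g.
Proof.
move=> fD gD fg; apply: bburn_ind => [|x y Ex Ey]; last first.
  by rewrite (morphDB fD) (morphDB gD) Ex Ey.
apply: (@action_ind _ (fun T to => forall fr : bifree to,
  f (bbclass fr) = g (bbclass fr))).
- move=> T1 T2 to1 to2 iso E fr2; have fr1 := iso_bifree (act_iso_sym iso) fr2.
  by rewrite -(bbclass_iso fr1 fr2 iso).
- move=> fr; rewrite (bbclass_iso fr (bifree_void gT) (act_iso_refl _)).
  by rewrite -[bbclass _]/(0 : bburnside gT) (morphD0 fD) (morphD0 gD).
move=> L T to E fr; have [fr1 fr2] := bifree_sumP fr.
by rewrite (bbclass_sum fr1 fr2) fD gD E fg.
Qed.

End BisetGeneration.

(** * Marks detect isomorphism *)

Section CommonPart.

Variable hT : finGroupType.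

Lemma afix_sum (T1 T2 : finType) (to1 : {action hT &-> T1})
    (to2 : {action hT &-> T2}) (A : {set hT}) :
  #|'Fix_(sum_action to1 to2)(A)%g| = (#|'Fix_to1(A)%g| + #|'Fix_to2(A)%g|)%N.
Proof.
have inlI : injective (@inl T1 T2) by move=> x y [].
have inrI : injective (@inr T1 T2) by move=> x y [].
have disj : [disjoint inl @: 'Fix_to1(A)%g & inr @: 'Fix_to2(A)%g].
  rewrite -setI_eq0; apply/eqP/setP => u; rewrite in_setI in_set0; apply/negP.
  by case/andP=> /imsetP[x _ ->] /imsetP[].
rewrite -(card_imset _ inlI) -(card_imset _ inrI) -cardsUI.
rewrite (disjoint_setI0 disj) cards0 addn0.
apply: eq_card => -[x|x]; rewrite in_setU.
  rewrite (mem_imset _ _ inlI) [X in _ || X](_ : _ = false) ?orbF.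
    by apply/afixP/afixP => H a /H => [[]|/= ->].
  by apply/imsetP => -[].
rewrite (mem_imset _ _ inrI) [X in X || _](_ : _ = false) /=.
  by apply/afixP/afixP => H a /H => [[]|/= ->].
by apply/imsetP => -[].
Qed.

Lemma afix_iso (T1 T2 : finType) (to1 : {action hT &-> T1})
    (to2 : {action hT &-> T2}) (A : {set hT}) :
  act_iso to1 to2 -> #|'Fix_to1(A)%g| = #|'Fix_to2(A)%g|.
Proof.
case=> f [g fK gK] fJ; rewrite -(card_imset _ (can_inj fK)).
apply: eq_card => y; rewrite -[y]gK (mem_imset _ _ (can_inj fK)).
apply/afixP/afixP => H a /H; rewrite -fJ; first by move->.
exact: can_inj fK _ _.
Qed.

Lemma afix_card_stab (T : finType) (to : {action hT &-> T}) (L : {group hT}) :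
  (0 < #|'Fix_to(L)%g|)%N <-> exists x, L \subset 'C[x | to]%g.
Proof.
split=> [/card_gt0P[x /afixP Hx]|[x /subsetP Hx]].
  by exists x; apply/subsetP => a /Hx Ea; apply/astab1P.
by apply/card_gt0P; exists x; apply/afixP => a /Hx/astab1P.
Qed.

Lemma sum_stab (T1 T2 : finType) (to1 : {action hT &-> T1})
    (to2 : {action hT &-> T2}) (P : {group hT} -> bool) :
  (forall u, P 'C[u | sum_action to1 to2]%G) ->
  (forall x, P 'C[x | to1]%G) /\ (forall x, P 'C[x | to2]%G).
Proof.
move=> H; split=> x; [have := H (inl x) | have := H (inr x)];
  congr (is_true (P _)); apply/val_inj/setP => a /=;
  by apply/astab1P/astab1P => [[]|/= ->].
Qed.

(** Burnside's argument, relative to a family P closed under subgroups: points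
with stabiliser outside P are matched in pairs.  A point of maximal stabiliser
L outside P on one side yields a point with the same stabiliser on the other
side, because the marks at L agree; the two orbits are then isomorphic and can
be split off.  With P empty this is Burnside's theorem; for P the subgroups of
conjugates of the diagonal it isolates the part of a biset outside the image
of iota. *)
Lemma common_part (P : {group hT} -> bool) (T1 T2 : finType)
    (to1 : {action hT &-> T1}) (to2 : {action hT &-> T2}) :
    (forall K L : {group hT}, K \subset L -> P L -> P K) ->
    (forall L : {group hT}, ~~ P L -> #|'Fix_to1(L)%g| = #|'Fix_to2(L)%g|) ->
  exists (T D1 D2 : finType) (to : {action hT &-> T}) (d1 : {action hT &-> D1})
      (d2 : {action hT &-> D2}),
    [/\ act_iso (sum_action to d1) to1, act_iso (sum_action to d2) to2,
        forall x, P 'C[x | d1]%G & forall x, P 'C[x | d2]%G].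
Proof.
move=> Pdown; have [n le_n] := ubnP #|T1|.
elim: n T1 T2 le_n to1 to2 => // n IHn T1 T2 le_n to1 to2 eq12.
have [x0 Px0|T1P] := pickP (fun x => ~~ P 'C[x | to1]%G); last first.
  exists void, T1, T2, (void_action hT), to1, to2.
  split=> [||x|y]; try exact: sum0_iso; first by have /negbFE := T1P x.
  apply/negPn/negP => Py; have /afix_card_stab[x Cx] : (0 < #|'Fix_to1('C[y | to2])%g|)%N.
    by rewrite (eq12 _ Py); apply/afix_card_stab; exists y.
  by case/negP: Py; apply: (Pdown _ 'C[x | to1]%G Cx); have /negbFE := T1P x.
pose Q x := ~~ P 'C[x | to1]%G.
case: (@arg_maxnP _ x0 Q (fun x => #|'C[x | to1]%g|) Px0) => x Px xmax.
have /afix_card_stab[y Cxy] : (0 < #|'Fix_to2('C[x | to1])%g|)%N.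
  by rewrite -(eq12 _ Px); apply/afix_card_stab; exists x.
have Py : ~~ P 'C[y | to2]%G by apply: contra Px; apply: Pdown Cxy.
have /afix_card_stab[x' Cyx'] : (0 < #|'Fix_to1('C[y | to2])%g|)%N.
  by rewrite (eq12 _ Py); apply/afix_card_stab; exists y.
have Px' : ~~ P 'C[x' | to1]%G by apply: contra Py; apply: Pdown Cyx'.
(* The stabilisers of x, y and x' form a chain, and that of x is maximal. *)
have Exy : 'C[x | to1]%G = 'C[y | to2]%G.
  apply/val_inj/eqP; rewrite /= eqEcard Cxy.
  exact: leq_trans (subset_leq_card Cyx') (xmax _ Px').
have [S1 [s1 [lt_S1 iso1]]] := orbit_split to1 x.
have [S2 [s2 [_ iso2]]] := orbit_split to2 y.
rewrite -Exy in iso2.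
have [L PL|T [D1 [D2 [to [d1 [d2 [i1 i2 Pd1 Pd2]]]]]]] :=
    IHn S1 S2 (leq_trans lt_S1 le_n) s1 s2.
  apply: (@addnI #|'Fix_(coset_action 'C[x | to1]%G)(L)%g|).
  by rewrite -!afix_sum (afix_iso _ iso1) (afix_iso _ iso2) eq12.
exists (coset_type 'C[x | to1]%G + T)%type, D1, D2,
  (sum_action (coset_action 'C[x | to1]%G) to), d1, d2.
split=> //; apply: act_iso_trans (act_iso_sym (sumA_iso _ _ _)) _.
  exact: act_iso_trans (sum_iso (act_iso_refl _) i1) iso1.
exact: act_iso_trans (sum_iso (act_iso_refl _) i2) iso2.
Qed.

Lemma no_points_iso (T1 T2 : finType) (to1 : {action hT &-> T1})
  (to2 : {action hT &-> T2}) : (T1 -> False) -> (T2 -> False) -> act_iso to1 to2.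
Proof.
by move=> n1 n2; apply: act_iso_trans (act_iso_sym (void_iso _ _)) (void_iso _ _);
  apply: eq_card0 => x; [case: (n1 x) | case: (n2 x)].
Qed.

Lemma marks_iso (T1 T2 : finType) (to1 : {action hT &-> T1})
    (to2 : {action hT &-> T2}) :
  (forall L : {group hT}, #|'Fix_to1(L)%g| = #|'Fix_to2(L)%g|) -> act_iso to1 to2.
Proof.
move=> eq12.
have [//|//|T [D1 [D2 [to [d1 [d2 [i1 i2 no1 no2]]]]]]] :=
  @common_part (fun _ => false) _ _ to1 to2.
apply: act_iso_trans (act_iso_sym i1) (act_iso_trans _ i2).
by apply: sum_iso (act_iso_refl _) (no_points_iso _ _ _ _) => x;
  [have := no1 x | have := no2 x].
Qed.

End CommonPart.

(** * Marks of the Burnside ring *)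

Section Marks.

Variable hT : finGroupType.
Implicit Types (A : {set hT}) (x y : burnside hT).

Definition gmark A : burnside hT -> int :=
  groth_lift (fun c : gset_class hT => #|'Fix_(gset_act (repr c))(A)%g|%:Z).

Fact gmark_gclD A :
  {morph (fun c : gset_class hT => #|'Fix_(gset_act (repr c))(A)%g|%:Z) : c d / c + d}.
Proof.
elim/gcl_ind=> T1 to1; elim/gcl_ind=> T2 to2 /=.
by rewrite gclD !(afix_iso _ (repr_gcl _)) afix_sum PoszD.
Qed.

Lemma gmarkD A : {morph gmark A : x y / x + y}.
Proof. exact: groth_liftD (gmark_gclD A). Qed.

Lemma gmark_class A (T : finType) (to : {action hT &-> T}) :
  gmark A (bclass to) = #|'Fix_to(A)%g|%:Z.
Proof. by rewrite /gmark (groth_lift_of (gmark_gclD A)) (afix_iso _ (repr_gcl _)). Qed.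

Lemma gmark1 A : gmark A 1 = 1.
Proof.
rewrite -[1]/(bclass (unit_action hT)) gmark_class; congr Posz.
rewrite -card_unit; apply: eq_card => -[]; apply/afixP => a _.
by case: (unit_action hT tt a).
Qed.

Lemma gmarkM A x y : gmark A (x * y) = gmark A x * gmark A y.
Proof.
elim/burn_ind: x => [T1 to1|x1 x2 E1 E2]; last first.
  by rewrite [_ * y]mulrBl !(morphDB (@gmarkD A)) E1 E2 [RHS]mulrBl.
elim/burn_ind: y => [T2 to2|y1 y2 E1 E2]; last first.
  by rewrite [_ * (y1 - y2)]mulrBr !(morphDB (@gmarkD A)) E1 E2 [RHS]mulrBr.
rewrite /bclass -groth_ofM gclM -!/(bclass _) !gmark_class -PoszM -cardsX.
congr Posz; apply: eq_card => -[u v]; rewrite in_setX /=.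
apply/afixP/andP => [H|[/afixP Hu /afixP Hv] a Aa].
  by split; apply/afixP => a /H [].
by rewrite /= /prod_act Hu ?Hv.
Qed.

(** Moving negative parts to the other side turns this into Burnside's theorem for
actual sets. *)
Lemma gmark_inj x y :
  (forall L : {group hT}, gmark L x = gmark L y) -> x = y.
Proof.
elim/groth_ind: x => a b; elim/groth_ind: y => c d.
elim/gcl_ind: a => T1 to1; elim/gcl_ind: b => T2 to2.
elim/gcl_ind: c => T3 to3; elim/gcl_ind: d => T4 to4 E.
apply/eq_gpair; exists 0; rewrite !addr0 !gclD; apply/eq_gcl/marks_iso => L.
have := E L; rewrite !gpairE !(morphDB (@gmarkD L)) -!/(bclass _) !gmark_class.
rewrite !afix_sum => /eqP; rewrite subr_eq addrAC eq_sym subr_eq -!PoszD.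
by move=> /eqP[].
Qed.

End Marks.

(** * Marks of bifree bisets and the product formula *)

Section BisetMarks.

Variable gT : finGroupType.
Local Notation gT2 := (gT * gT)%type.
Implicit Types (A : {set gT2}) (x y : bburnside gT).

Definition bmark A : bburnside gT -> int :=
  groth_lift (fun c : bset_class gT => #|'Fix_(gset_act (val (repr c)))(A)%g|%:Z).

Fact bmark_bclD A :
  {morph (fun c : bset_class gT => #|'Fix_(gset_act (val (repr c)))(A)%g|%:Z)
    : c d / c + d}.
Proof.
elim/bcl_ind=> T1 to1 fr1; elim/bcl_ind=> T2 to2 fr2 /=.
by rewrite bclD !(afix_iso _ (repr_bcl _)) afix_sum PoszD.
Qed.

Lemma bmarkD A : {morph bmark A : x y / x + y}.
Proof. exact: groth_liftD (bmark_bclD A). Qed.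

Lemma bmark_class A (T : finType) (to : {action gT2 &-> T}) (fr : bifree to) :
  bmark A (bbclass fr) = #|'Fix_to(A)%g|%:Z.
Proof. by rewrite /bmark (groth_lift_of (bmark_bclD A)) (afix_iso _ (repr_bcl _)). Qed.

(** Families over an arbitrary finite type stand for generators of twisted
diagonal subgroups.  They are not required to extend to homomorphisms, so that
the sum in the product formula ranges over the whole type [{ffun I -> gT}]. *)
Definition graph (I : finType) (alpha beta : {ffun I -> gT}) : {set gT2} :=
  [set (alpha i, beta i) | i : I].

Lemma afix_graphP (I : finType) (alpha beta : {ffun I -> gT}) (T : finType)
    (to : {action gT2 &-> T}) t :
  reflect (forall i, to t (alpha i, beta i) = t) (t \in 'Fix_to(graph alpha beta)%g).
Proof.
apply: (iffP afixP) => [H i|H _ /imsetP[i _ ->]]; last exact: H.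
by apply: H; apply: imset_f.
Qed.

(** Taking all pairs in L as generators, padded by 1, shows that marks at graphs
include the marks at all subgroups. *)
Lemma graph_group (L : {group gT2}) :
  exists alpha beta : {ffun gT2 -> gT}, graph alpha beta = L.
Proof.
exists [ffun c => if c \in L then c.1 else 1%g],
       [ffun c => if c \in L then c.2 else 1%g].
apply/setP => e; apply/imsetP/idP => [[i _ ->]|Le].
  by rewrite !ffunE; case: ifP => [|_]; [case: i | exact: group1].
by exists e; rewrite // !ffunE Le; case: e Le.
Qed.

Lemma bmark_inj x y :
  (forall alpha beta : {ffun gT2 -> gT},
    bmark (graph alpha beta) x = bmark (graph alpha beta) y) -> x = y.
Proof.
elim/groth_ind: x => a b; elim/groth_ind: y => c d.
elim/bcl_ind: a => T1 to1 fr1; elim/bcl_ind: b => T2 to2 fr2.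
elim/bcl_ind: c => T3 to3 fr3; elim/bcl_ind: d => T4 to4 fr4 E.
apply/eq_gpair; exists 0; rewrite !addr0 !bclD; apply/eq_bcl/marks_iso => L.
have [al [be EL]] := graph_group L.
have := E al be; rewrite EL !gpairE !(morphDB (@bmarkD L)) -!/(bbclass _) !bmark_class.
rewrite !afix_sum => /eqP; rewrite subr_eq addrAC eq_sym subr_eq -!PoszD.
by move=> /eqP[].
Qed.

Section TensorMarks.

Variables (T1 T2 : finType) (to1 : {action gT2 &-> T1}) (to2 : {action gT2 &-> T2}).
Hypothesis fr1 : bifree to1.

(** A pair in the tensor product is only defined up to a middle translation by k,
hence the middle coordinate k. *)
Lemma tpair_fixP u c :
  tens_action to1 to2 (tpair to1 to2 u) c = tpair to1 to2 u <->
  exists k, to1 u.1 (c.1, k) = u.1 /\ to2 u.2 (k, c.2) = u.2.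
Proof.
have lr k : rmul to1 (lmul to1 c.1^-1%g u.1) k = to1 u.1 (c.1, k).
  by rewrite act_lrmul lrmul.
have rl k : lmul to2 k^-1%g (rmul to2 u.2 c.2) = to2 u.2 (k, c.2).
  by rewrite act_lrmul.
rewrite /= tpairJ eq_tpair /=.
split=> [[k E1 E2]|[k [E1 E2]]]; exists k; rewrite ?lr ?rl //.
by rewrite -lr -rl.
Qed.

Lemma act_inj_right t a k l : to1 t (a, k) = to1 t (a, l) -> k = l.
Proof.
move=> /act_eqE/astab1P E; have [_ Fr] := bifreeP _ fr1.
apply/esym/eqP; rewrite eq_mulgV1; apply/eqP/(Fr _ t).
by rewrite /rmul -[RHS]E; congr (to1 t (_, _)); rewrite /= mulgV.
Qed.

(** Freeness on the right of the first factor makes the middle family beta unique,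
so the set of such beta has one element or none. *)
Lemma tens_fix_graph (I : finType) (alpha gamma : {ffun I -> gT}) u :
  #|[set beta : {ffun I -> gT} | (u.1 \in 'Fix_to1(graph alpha beta)%g)
                              && (u.2 \in 'Fix_to2(graph beta gamma)%g)]|
  = (tpair to1 to2 u \in 'Fix_(tens_action to1 to2)(graph alpha gamma)%g).
Proof.
apply/esym; case: afix_graphP => [H|nH] /=.
  have /fin_all_exists[k Hk] i := (tpair_fixP _ _).1 (H i).
  apply/esym; rewrite -(cards1 (finfun k)); apply: eq_card => beta.
  rewrite in_set in_set1; apply/andP/eqP => [[/afix_graphP H1 _]|->].
    apply/ffunP => i; rewrite ffunE.
    by apply: act_inj_right (etrans (H1 i) (esym (Hk i).1)).
  by split; apply/afix_graphP => i; rewrite ffunE; case: (Hk i).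
apply/esym/eq_card0 => beta; rewrite in_set; apply/negP.
case/andP => /afix_graphP H1 /afix_graphP H2; apply: nH => i.
by apply/tpair_fixP; exists (beta i); split; [exact: H1 | exact: H2].
Qed.

(** The middle action of G on pairs is free, so its orbits are copies of G. *)
Lemma tpair_fiber (O : tens_type to1 to2) : #|[set u | tpair to1 to2 u == O]| = #|gT|.
Proof.
have [u0 <-] := tpair_surj O.
have mid_inj : injective (mid_act to1 to2 u0).
  by move=> k l [E _]; apply: act_inj_right E.
rewrite -cardsT -(card_imset _ mid_inj); apply: eq_card => v; rewrite !inE.
apply/eqP/imsetP => [/esym/eq_tpair[k E1 E2]|[k _ ->]].
  by exists k; rewrite // /mid_act -E1 -E2 -surjective_pairing.
by apply/esym/eq_tpair; exists k.
Qed.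

(** Both sides count the pairs (u1, u2) whose class is fixed: the left side by
fibres of the projection to the tensor product, the right side by the unique
middle family beta. *)
Lemma afix_tens (I : finType) (alpha gamma : {ffun I -> gT}) :
  (#|gT| * #|'Fix_(tens_action to1 to2)(graph alpha gamma)%g|)%N =
  (\sum_(beta : {ffun I -> gT})
    #|'Fix_to1(graph alpha beta)%g| * #|'Fix_to2(graph beta gamma)%g|)%N.
Proof.
under [RHS]eq_bigr => beta _ do rewrite -cardsX -sum1dep_card big_mkcond /=.
rewrite exchange_big /= (partition_big (tpair to1 to2) predT) //=.
rewrite -[X in (_ * X)%N]sum1_card big_distrr /= [LHS]big_mkcond /=.
apply: eq_bigr => A _.
transitivity (\sum_(u | tpair to1 to2 u == A)
    (A \in 'Fix_(tens_action to1 to2)(graph alpha gamma)%g : nat))%N.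
  rewrite sum_nat_cond_const tpair_fiber.
  by case: (A \in _); rewrite ?muln1 ?muln0.
apply: eq_bigr => u /eqP <-; rewrite -tens_fix_graph -sum1dep_card big_mkcond /=.
by apply: eq_bigr => beta _; case: u => u1 u2; rewrite -in_setX.
Qed.

End TensorMarks.

Lemma bmarkM (I : finType) (alpha gamma : {ffun I -> gT}) x y :
  #|gT|%:Z * bmark (graph alpha gamma) (x * y) =
  \sum_(beta : {ffun I -> gT})
    bmark (graph alpha beta) x * bmark (graph beta gamma) y.
Proof.
elim/bburn_ind: x => [T1 to1 fr1|x1 x2 E1 E2]; last first.
  rewrite [(x1 - x2) * y]mulrBl (morphDB (@bmarkD _)) mulrBr E1 E2 -sumrB.
  by apply: eq_bigr => beta _; rewrite (morphDB (@bmarkD _)) [RHS]mulrBl.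
elim/bburn_ind: y => [T2 to2 fr2|y1 y2 E1 E2]; last first.
  rewrite [_ * (y1 - y2)]mulrBr (morphDB (@bmarkD _)) mulrBr E1 E2 -sumrB.
  by apply: eq_bigr => beta _; rewrite (morphDB (@bmarkD _)) [RHS]mulrBr.
rewrite /bbclass -groth_ofM bclM -!/(bbclass _) bmark_class -PoszM.
rewrite (afix_tens to2 fr1) (big_morph Posz PoszD (erefl 0%:Z)).
by apply: eq_bigr => beta _; rewrite PoszM !bmark_class.
Qed.

End BisetMarks.

(** * Marks of 1 and of the images of iota, eta and the anti-involution *)

Section MarksOfMaps.

Variable gT : finGroupType.
Local Notation gT2 := (gT * gT)%type.
Implicit Types (u v : burnside gT) (x y : bburnside gT) (phi psi : autG gT).

Section ConjugationOnFamilies.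
Variable I : finType.
Implicit Types alpha beta gamma : {ffun I -> gT}.

Definition fconj alpha g : {ffun I -> gT} := [ffun i => (alpha i ^ g)%g].
Fact fconj1 : fconj^~ 1%g =1 id.
Proof. by move=> al; apply/ffunP => i; rewrite ffunE conjg1. Qed.
Fact fconjM alpha : act_morph fconj alpha.
Proof. by move=> g h; apply/ffunP => i; rewrite !ffunE conjgM. Qed.
Definition fconj_action := TotalAction fconj1 fconjM.

Definition fauto phi alpha : {ffun I -> gT} := [ffun i => phi (alpha i)].

Lemma fautoK phi : cancel (fauto phi) (fauto phi^-1%g).
Proof. by move=> al; apply/ffunP => i; rewrite !ffunE -autGM mulVg autG1. Qed.

Lemma fautoV phi : cancel (fauto phi^-1%g) (fauto phi).
Proof. by move=> al; apply/ffunP => i; rewrite !ffunE -autGM mulgV autG1. Qed.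

Lemma bmark1E alpha beta :
  bmark (graph alpha beta) 1 = #|[set g | fconj alpha g == beta]|%:Z.
Proof.
rewrite -[1]/(bbclass (bifree_reg gT)) bmark_class; apply: (congr1 Posz).
apply: eq_card => g; rewrite [RHS]in_set; apply/afix_graphP/eqP => [H|<- i].
  apply/ffunP => i; rewrite ffunE conjgE; apply: (mulgI g).
  by rewrite mulKVg -{1}(H i) /= /reg_act /= !mulgA mulgV mul1g.
by rewrite /= /reg_act /= ffunE conjgE !mulgA mulgK mulVg mul1g.
Qed.

Lemma bmark1_stab alpha :
  bmark (graph alpha alpha) 1 = #|'C[alpha | fconj_action]%g|%:Z.
Proof.
rewrite bmark1E; apply: (congr1 Posz); apply: eq_card => g.
by rewrite in_set; apply/eqP/astab1P.
Qed.

(** The identity biset contributes exactly the conjugacies between two families. *)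
Lemma bmark1_neq0 alpha beta :
  (bmark (graph alpha beta) 1 != 0) = (beta \in orbit fconj_action [set: gT] alpha).
Proof.
rewrite bmark1E eqz_nat -lt0n; apply/card_gt0P/orbitP => [[g]|[g _ E]].
  by rewrite in_set => /eqP; exists g.
by exists g; rewrite in_set; apply/eqP.
Qed.

Lemma bmark1_auto phi alpha beta :
  bmark (graph (fauto phi alpha) (fauto phi beta)) 1 = bmark (graph alpha beta) 1.
Proof.
rewrite !bmark1E; apply: (congr1 Posz); rewrite -[RHS](card_imset _ (@autG_inj _ phi)).
have phiJ a g : phi (a ^ g)%g = (phi a ^ phi g)%g by rewrite -!autGmE morphJ ?inE.
apply: eq_card => g; rewrite -[g](autG1) -(mulgV phi) autGM.
rewrite (mem_imset _ _ (@autG_inj _ phi)) !in_set.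
apply/eqP/eqP => /ffunP E; apply/ffunP => i; have := E i; rewrite !ffunE -phiJ.
  exact: autG_inj.
by move=> ->.
Qed.

Definition fmark alpha u : int := gmark [set alpha i | i : I] u.

Lemma fmark_orbit alpha beta u :
  beta \in orbit fconj_action [set: gT] alpha -> fmark beta u = fmark alpha u.
Proof.
case/orbitP => g _ <-; elim/burn_ind: u => [T to|u v Eu Ev]; last first.
  by rewrite /fmark !(morphDB (@gmarkD _ _)) -!/(fmark _ _) Eu Ev.
rewrite /fmark !gmark_class; apply: (congr1 Posz).
rewrite -[RHS](card_imset _ (act_inj to g)); apply: eq_card => t.
rewrite -[t](actKV to g) (mem_imset _ _ (act_inj to g)).
apply/afixP/afixP => H _ /imsetP[i _ ->].
  apply: (act_inj to g); rewrite -[RHS](H (alpha i ^ g)%g); last first.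
    by apply/imsetP; exists i; rewrite //= ffunE.
  by rewrite -!actM conjgE mulKVg.
rewrite /= ffunE conjgE -actM mulKVg !actM H //; exact: imset_f.
Qed.

End ConjugationOnFamilies.

Lemma bbtransE_trans (L : {group gT2}) (T : finType) (to : {action gT2 &-> T})
    (fr : bifree to) t :
  (forall t', exists c, to t c = t') -> 'C[t | to]%g = L -> bbtrans L = bbclass fr.
Proof.
move=> tr st; have iso := coset_iso tr st.
have frL := iso_bifree (act_iso_sym iso) fr.
by rewrite (bbtransE frL); apply: bbclass_iso.
Qed.

(** The biset U x G, with G acting on both factors from the left and on the second
from the right.  It represents the image of U under iota for every G-set U,
and its fixed points visibly form a product. *)
Section InducedBiset.
Variables (T : finType) (to : {action gT &-> T}).
Definition ind_act (p : T * gT) (c : gT2) := (to p.1 c.1, reg_act p.2 c).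
Fact ind_act1 : ind_act^~ 1%g =1 id.
Proof. by case=> t g; rewrite /ind_act act1 reg_act1. Qed.
Fact ind_actM p : act_morph ind_act p.
Proof. by move=> c d; rewrite /ind_act actM reg_actM. Qed.
Definition ind_action := TotalAction ind_act1 ind_actM.

Lemma bifree_ind : bifree ind_action.
Proof.
have [Fl Fr] := bifreeP _ (bifree_reg gT).
by apply/bifreeP; split=> g [t h] [_]; [apply: Fl | apply: Fr].
Qed.
End InducedBiset.

(** Fixing a point of U x G means conjugating alpha to beta and fixing a point of U
under all alpha_i. *)
Lemma iota_bmark (I : finType) (alpha beta : {ffun I -> gT}) u :
  bmark (graph alpha beta) (iotaB u) = bmark (graph alpha beta) 1 * fmark alpha u.
Proof.
move: u; apply: burn_eq => [u v|u v|R].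
- by rewrite iotaBD bmarkD.
- by rewrite /fmark gmarkD mulrDr.
pose to := ind_action (coset_action R).
rewrite iota_trans (@bbtransE_trans _ _ to (bifree_ind _) (coset_base R, 1%g)).
- rewrite -[1]/(bbclass (bifree_reg gT)) /fmark !bmark_class gmark_class.
  rewrite -PoszM mulnC -cardsX; apply: (congr1 Posz); apply: eq_card => -[t g].
  rewrite in_setX; apply/afix_graphP/andP => [H|[/afixP Ht /afix_graphP Hg] i].
    split; last by apply/afix_graphP => i; case: (H i).
    by apply/afixP => _ /imsetP[i _ ->]; case: (H i).
  congr (_, _); last exact: Hg.
  by apply: Ht; apply: imset_f.
- case=> A g; have [a <-] := coset_base_tr A; exists (a, a * g)%g.
  by congr (_, _); rewrite /reg_act /= mulg1 mulKg.
have RE b : (b \in R) = (b \in 'C[coset_base R | coset_action R]%g).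
  by rewrite coset_base_stab.
apply/setP => -[a b]; rewrite mem_diag /= RE.
apply/astab1P/andP => [[E1]|[/eqP -> /astab1P E]].
  rewrite /reg_act /= mulg1 => E2.
  have Eab : a = b by apply/eqP; rewrite eq_mulVg1 E2.
  by rewrite -Eab eqxx; split=> //; apply/astab1P/val_inj.
by congr (_, _); rewrite // /reg_act /= mulg1 mulVg.
Qed.

(** G with its right action twisted by phi, a model of [(G x G)/Delta(G, phi, G)]. *)
Section TwistedRegular.
Variable phi : autG gT.
Definition auto_act (t : gT) (c : gT2) := reg_act t (c.1, phi c.2).
Fact auto_act1 : auto_act^~ 1%g =1 id.
Proof. by move=> t; rewrite /auto_act /= -autGmE morph1 reg_act1. Qed.
Fact auto_actM t : act_morph auto_act t.
Proof. by move=> c d; rewrite /auto_act /= autG_morphM -reg_actM. Qed.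
Definition auto_action := TotalAction auto_act1 auto_actM.

Lemma bifree_auto : bifree auto_action.
Proof.
have [Fl Fr] := bifreeP _ (bifree_reg gT).
apply/bifreeP; split=> g t; rewrite /lmul /rmul /= /auto_act /=.
  by rewrite -autGmE morph1; apply: Fl.
by move/Fr => E; apply: (@autG_inj _ phi); rewrite E -autGmE morph1.
Qed.

Lemma bbtrans_autdiag : bbtrans (autdiag phi) = bbclass bifree_auto.
Proof.
apply: (@bbtransE_trans _ _ _ _ 1%g) => [g|].
  by exists (g^-1, 1)%g; rewrite /= /auto_act /reg_act /= invgK -autGmE morph1 !mulg1.
apply/setP => -[a b]; rewrite mem_autdiag /=; apply/astab1P/eqP.
  rewrite /= /auto_act /reg_act /= mulg1 => E.
  by apply/eqP; rewrite eq_mulVg1 E.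
by rewrite /= /auto_act /reg_act /= mulg1 => ->; rewrite mulVg.
Qed.

Lemma autdiag_bmark (I : finType) (alpha beta : {ffun I -> gT}) :
  bmark (graph alpha beta) (bbtrans (autdiag phi)) =
  bmark (graph alpha (fauto phi beta)) 1.
Proof.
rewrite bbtrans_autdiag -[1]/(bbclass (bifree_reg gT)) !bmark_class; apply: (congr1 Posz).
apply: eq_card => g.
by apply/afix_graphP/afix_graphP => H i; have := H i; rewrite /= /auto_act ffunE.
Qed.
End TwistedRegular.

Section OppositeBiset.
Variables (T : finType) (to : {action gT2 &-> T}).
Definition op_act (t : T) (c : gT2) := to t (c.2, c.1).
Fact op_act1 : op_act^~ 1%g =1 id.
Proof. by move=> t; rewrite /op_act act1. Qed.
Fact op_actM t : act_morph op_act t.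
Proof. by move=> c d; rewrite /op_act -actM. Qed.
Definition op_action := TotalAction op_act1 op_actM.

Lemma bifree_op : bifree to -> bifree op_action.
Proof.
move=> /bifreeP[Fl Fr]; apply/bifreeP; split=> g t E.
  by apply/eqP; rewrite -eq_invg1; apply/eqP; apply: (Fr _ t).
by apply/eqP; rewrite -eq_invg1; apply/eqP; apply: (Fl _ t); rewrite /lmul invgK.
Qed.
End OppositeBiset.

(** The opposite biset has the same points, with the two actions exchanged. *)
Lemma bop_bmark (I : finType) (alpha beta : {ffun I -> gT}) x :
  bmark (graph alpha beta) (bop x) = bmark (graph beta alpha) x.
Proof.
move: x; apply: bburn_eq => [x y|x y|L fr]; first by rewrite bopD bmarkD.
  by rewrite bmarkD.
rewrite -(bbtransE fr) [bop _](bburn_ext_trans (@bopJ gT) fr).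
rewrite (@bbtransE_trans _ _ _ (bifree_op fr) (coset_base L)).
- rewrite (bmark_class _ (bifree_op fr)) (bbtransE fr) (bmark_class _ fr).
  apply: (congr1 Posz); apply: eq_card => t.
  by apply/afix_graphP/afix_graphP.
- by move=> A; have [[a b] <-] := coset_base_tr A; exists (b, a).
have LE c : (c \in L) = (c \in 'C[coset_base L | coset_action L]%g).
  by rewrite coset_base_stab.
apply/setP => -[a b]; rewrite mem_swap /= LE.
by apply/astab1P/astab1P.
Qed.

(** Transport of an action along phi; it represents the action of the class of phi
on B(G). *)
Section TwistedAction.
Variables (phi : autG gT) (T : finType) (to : {action gT &-> T}).
Definition twist_act (t : T) (g : gT) := to t (autG_fun phi^-1%g g).
Fact twist_act1 : twist_act^~ 1%g =1 id.
Proof. by move=> t; rewrite /twist_act -autGmE morph1 act1. Qed.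
Fact twist_actM t : act_morph twist_act t.
Proof. by move=> c d; rewrite /twist_act autG_morphM actM. Qed.
Definition twist_action := TotalAction twist_act1 twist_actM.
End TwistedAction.

Lemma out_act_fmark phi (I : finType) (alpha : {ffun I -> gT}) u :
  fmark (fauto phi alpha) (out_act (outc phi) u) = fmark alpha u.
Proof.
have phiK : cancel phi (autG_fun phi^-1%g) by move=> g; rewrite -autGM mulVg autG1.
have phiKV : cancel (autG_fun phi^-1%g) phi by move=> g; rewrite -autGM mulgV autG1.
move: u; apply: burn_eq => [u v|u v|R]; first by rewrite out_actD /fmark gmarkD.
  by rewrite /fmark gmarkD.
rewrite out_act_trans.
have iso : act_iso (coset_action (autGm phi @* R)%G)
                   (twist_action phi (coset_action R)).
  apply: (@coset_iso _ _ _ (coset_base R)) => [A|].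
    have [a <-] := coset_base_tr A; exists (phi a).
    by rewrite /= /twist_act phiK.
  have RE h : (h \in R) = (h \in 'C[coset_base R | coset_action R]%g).
    by rewrite coset_base_stab.
  apply/setP => g; rewrite -{1}[g]phiKV.
  apply/astab1P/morphimP => [|[h _ Rh ->]].
    rewrite /= /twist_act phiK => E; exists (autG_fun phi^-1%g g); rewrite ?inE //.
      by rewrite RE; apply/astab1P.
    by rewrite autGmE phiKV.
  by rewrite autGmE phiKV /= /twist_act phiK; move: Rh; rewrite RE => /astab1P.
rewrite /fmark /btrans (bclass_iso iso) !gmark_class.
apply: (congr1 Posz); apply: eq_card => t.
apply/afixP/afixP => H _ /imsetP[i _ ->].
  have := H (phi (alpha i)); rewrite /= /twist_act phiK; apply.
  by apply/imsetP; exists i; rewrite ?ffunE.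
by rewrite ffunE /= /twist_act phiK; apply: H; apply: imset_f.
Qed.

End MarksOfMaps.

(** * Coefficients of rho are marks at automorphisms *)

Section RhoMarks.

Variable gT : finGroupType.
Local Notation gT2 := (gT * gT)%type.
Implicit Types (x y : bburnside gT) (phi psi : autG gT).

Definition idfam : {ffun gT -> gT} := [ffun g => g].
Local Notation fam phi := (fauto phi idfam).

Lemma act_inj_left (T : finType) (to : {action gT2 &-> T}) t a k l :
  bifree to -> to t (k, a) = to t (l, a) -> k = l.
Proof.
move=> /bifreeP[Fl _] /act_eqE/astab1P E.
apply/esym/eqP; rewrite eq_mulgV1 -eq_invg1; apply/eqP/(Fl _ t).
by rewrite /lmul invgK -[RHS]E; congr (to t (_, _)); rewrite /= mulgV.
Qed.

Lemma fam_orbit phi psi :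
  fam psi \in orbit (@fconj_action gT gT) [set: gT] (fam phi) -> outc phi = outc psi.
Proof.
case/orbitP => g _ /ffunP E; apply/eq_outc; exists g => h.
by have := E h; rewrite !ffunE => <-; rewrite conjgE mulKVg mulgK.
Qed.

(** By bifreeness a stabiliser is the graph of a partial injection of G, so it
cannot properly contain the graph of an automorphism. *)
Lemma coset_fix_autdiag (L : {group gT2}) phi t :
    bifree (coset_action L) ->
    t \in 'Fix_(coset_action L)(graph (fam phi) idfam)%g ->
  exists psi, L = autdiag psi.
Proof.
move=> fr /afix_graphP H.
have St : 'C[t | coset_action L]%g = autdiag phi.
  apply/setP => -[a b]; rewrite mem_autdiag /=.
  have Hb := H b; rewrite !ffunE in Hb.
  apply/astab1P/eqP => [E|->//].
  by apply: act_inj_left fr (etrans E (esym Hb)).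
have [a Ea] := coset_base_tr t.
have [psi _ Epsi] := autdiagJ phi a^-1%g; exists psi; rewrite -Epsi.
apply: val_inj; rewrite -[RHS]/(autdiag phi :^ a^-1)%g -St -Ea astab1_act ?inE // conjsgK.
by rewrite coset_base_stab.
Qed.

(** On a transitive biset both sides vanish unless it is the twisted regular biset
of an automorphism in the class of phi, which has |Z(G)| fixed points; the
mark of 1 at the identity family is |Z(G)|. *)
Lemma rho_bmark x phi :
  rhoB x (outc phi) * bmark (graph idfam idfam) 1 = bmark (graph (fam phi) idfam) x.
Proof.
move: x; apply: bburn_eq => [x y|x y|L fr].
- by rewrite rhoBD ffunE mulrDl.
- by rewrite bmarkD.
rewrite -(bbtransE fr).
have [[psi EL]|no] := pselect (exists psi, L = autdiag psi).
  rewrite EL rho_autdiag ffunE; case: eqP => [E|nE].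
    by rewrite mul1r -(autdiag_outc E) autdiag_bmark bmark1_auto.
  rewrite mul0r autdiag_bmark; apply/esym/eqP; apply: contraT.
  by rewrite bmark1_neq0 => /fam_orbit.
have -> : rhoB (bbtrans L) = 0.
  rewrite [rhoB _](bburn_ext_trans (@rhoJ gT) fr).
  by case: pickP => // psi /eqP E; case: no; exists psi.
rewrite ffunE mul0r (bbtransE fr) bmark_class; apply: (congr1 Posz).
apply/esym/eq_card0 => t; apply/negP => /(coset_fix_autdiag fr).
exact: no.
Qed.

(** If alpha_g t = t g for all g, then freeness of both actions forces alpha to be
multiplicative and injective. *)
Lemma bmark_fam x (alpha : {ffun gT -> gT}) :
  bmark (graph alpha idfam) x != 0 -> exists phi, alpha = fam phi.
Proof.
move=> nz; apply: contrapT => no; case/eqP: nz; move: x.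
apply: bburn_ind => [T to fr|x y Ex Ey]; last first.
  by rewrite (morphDB (@bmarkD _ _)) Ex Ey subrr.
rewrite bmark_class; apply: (congr1 Posz); apply/eq_card0 => t.
apply/negP => /afix_graphP H; apply: no.
have {}H i : to t (alpha i, i) = t by have := H i; rewrite ffunE.
have aM : {morph alpha : g h / (g * h)%g}.
  move=> g h; apply: (act_inj_left fr (t := t) (a := (g * h)%g)).
  by rewrite H -[LHS](H h) -{1}[t](H g) -actM.
have aI : injective alpha.
  move=> g h E; apply: (act_inj_right fr (t := t) (a := alpha g)).
  by rewrite H E H.
have aA : perm aI \in Aut [set: gT].
  rewrite inE; apply/andP; split; first by apply/subsetP => g; rewrite inE.
  by apply/morphicP => g h _ _; rewrite !permE aM.
exists (Sub (perm aI) aA); apply/ffunP => g.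
by rewrite !ffunE /autG_fun /= permE.
Qed.

End RhoMarks.

(** * Rigidity of the marks of orthogonal units *)

Section OrthogonalMarks.

Variable gT : finGroupType.
Local Notation gT2 := (gT * gT)%type.
Implicit Types (x y : bburnside gT) (u v : burnside gT).

Section Conjugation.
Variable I : finType.
Implicit Types alpha beta gamma : {ffun I -> gT}.
Local Notation forb := (orbit (@fconj_action gT I) [set: gT]).
Local Notation fstab alpha := (#|'C[alpha | @fconj_action gT I]%g|).

(** Translation by g on the right exchanges the fixed points for beta and for its
conjugate by g. *)
Lemma bmark_orbitr alpha beta beta' x :
  beta' \in forb beta -> bmark (graph alpha beta') x = bmark (graph alpha beta) x.
Proof.
case/orbitP => g _ <-; elim/bburn_ind: x => [T to fr|x y Ex Ey]; last first.
  by rewrite !(morphDB (@bmarkD _ _)) Ex Ey.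
rewrite !bmark_class; apply: (congr1 Posz).
rewrite -[RHS](card_imset _ (act_inj to (1, g)%g)); apply: eq_card => t.
rewrite -[t](actKV to (1, g)%g) (mem_imset _ _ (act_inj to _)).
move: (to t _) => s {t}.
have J i : to (to s (1, g)%g) (alpha i, fconj beta g i)
           = to (to s (alpha i, beta i)) (1, g)%g.
  rewrite -!actM; congr (to s (_, _)); rewrite /= ?mulg1 ?mul1g //.
  by rewrite ffunE conjgE mulKVg.
apply/afix_graphP/afix_graphP => H i; last by rewrite /= J H.
by apply: (act_inj to (1, g)%g); rewrite /= -J; apply: H.
Qed.

Lemma bop_involutive : involutive (@bop gT).
Proof. by move=> x; apply: bmark_inj => al be; rewrite !bop_bmark. Qed.

Lemma bmark_orbitl alpha alpha' beta x :
  alpha' \in forb alpha -> bmark (graph alpha' beta) x = bmark (graph alpha beta) x.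
Proof.
move=> H; rewrite -[x]bop_involutive !(bop_bmark _ _ (bop x)).
exact: bmark_orbitr.
Qed.

Lemma free_card_dvd (T : finType) (to : {action gT &-> T}) (A : {group gT})
    (S : {set T}) :
    [acts A, on S | to] -> (forall t a, t \in S -> a \in A -> to t a = t -> a = 1%g) ->
  (#|A| %| #|S|)%N.
Proof.
move=> actsA freeA; rewrite -(acts_sum_card_orbit actsA).
apply: (big_ind (fun n => #|A| %| n)%N) => [//|m n|O /imsetP[t St ->]].
  exact: dvdn_add.
rewrite card_orbit (_ : 'C_A[t | to]%g = 1%g) ?indexg1 //.
apply/trivgP/subsetP => a /setIP[Aa /astab1P E]; rewrite inE.
by apply/eqP/(freeA t).
Qed.

(** The centraliser of alpha acts from the left on the fixed points, freely since
the biset is bifree. *)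
Lemma stab_dvd_bmark alpha beta x :
  ((fstab alpha)%:Z %| bmark (graph alpha beta) x)%Z.
Proof.
elim/bburn_ind: x => [T to fr|x y Ex Ey]; last first.
  by rewrite (morphDB (@bmarkD _ _)) rpredB.
rewrite bmark_class dvdzE /=.
pose lact t g := to t (g, 1)%g.
have lact1 : lact^~ 1%g =1 id by move=> t; rewrite /lact act1.
have lactM t : act_morph lact t.
  by move=> g h; rewrite /lact -actM; congr (to t (_, _)); rewrite /= mulg1.
pose lto := TotalAction lact1 lactM.
apply: (@free_card_dvd _ lto) => [|t a _ _]; last first.
  move=> E; apply: (act_inj_left (to := to) (t := t) (a := 1%g) fr).
  by rewrite act1.
apply/actsP => a Ca t; move/astab1P/ffunP: (Ca) => /= Ea.
have J i : to (lto t a) (alpha i, beta i) = lto (to t (alpha i, beta i)) a.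
  rewrite /= /lact -!actM; congr (to t (_, _)); rewrite /= ?mulg1 ?mul1g //.
  by rewrite -[in LHS](Ea i) ffunE conjgE mulKVg.
apply/afix_graphP/afix_graphP => H i; last by rewrite J H.
by apply: (act_inj lto a); rewrite -J; apply: H.
Qed.

(** The opposite element turns divisibility by the order of the left stabiliser into
divisibility by that of the right one. *)
Lemma bmark_sqr_ge alpha beta x : bmark (graph alpha beta) x != 0 ->
  (fstab alpha * fstab beta)%N%:Z <= bmark (graph alpha beta) x ^+ 2.
Proof.
move=> nz; rewrite -[X in _ <= X]gez0_abs ?sqr_ge0 // abszX lez_nat -mulnn.
have n0 : (0 < `|bmark (graph alpha beta) x|)%N by rewrite absz_gt0.
apply: leq_mul; apply: dvdn_leq => //.
  by have := stab_dvd_bmark alpha beta x; rewrite dvdzE.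
by have := stab_dvd_bmark beta alpha (bop x); rewrite bop_bmark dvdzE.
Qed.

(** This is the diagonal entry at alpha of the product formula for x x^o = 1. *)
Lemma orth_row_sum alpha x : x * bop x = 1 ->
  \sum_beta bmark (graph alpha beta) x ^+ 2 = #|gT|%:Z * (fstab alpha)%:Z.
Proof.
move=> xx1; rewrite -bmark1_stab -xx1 bmarkM; apply: eq_bigr => beta _.
by rewrite bop_bmark expr2.
Qed.

(** The |G| / c(beta) conjugates of beta contribute at least
(|G| / c(beta)) c(alpha) c(beta) = |G| c(alpha) to the sum of squares in row
alpha, which is its total value: equality holds and all other terms vanish. *)
Lemma orth_row alpha beta x : x * bop x = 1 -> bmark (graph alpha beta) x != 0 ->
  bmark (graph alpha beta) x ^+ 2 = (fstab alpha * fstab beta)%N%:Z /\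
  forall beta', bmark (graph alpha beta') x != 0 -> beta' \in forb beta.
Proof.
move=> xx1 nz; have := orth_row_sum alpha xx1.
rewrite (bigID (fun b => b \in forb beta)) /=.
rewrite (eq_bigr (fun=> bmark (graph alpha beta) x ^+ 2)); last first.
  by move=> b /bmark_orbitr ->.
rewrite sumr_const; set m2 := bmark _ x ^+ 2; set r := \sum_(i | _) _ => Esum.
have r_ge0 : 0 <= r by apply: sumr_ge0 => b _; apply: sqr_ge0.
have m2_ge := bmark_sqr_ge nz; rewrite -/m2 in m2_ge.
have oE : (#|forb beta| * fstab beta = #|gT|)%N.
  by rewrite -cardsT -(card_orbit_stab (@fconj_action gT I) [set: gT] beta) setTI.
have Ge0 : (0 < #|gT|)%N by apply/card_gt0P; exists 1%g.
have cb0 : (0 < fstab beta)%N by rewrite cardG_gt0.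
(* The row sum multiplied by c(beta), as a sum of two nonnegative defects. *)
have key : #|gT|%:Z * (m2 - (fstab alpha * fstab beta)%N%:Z) + r * (fstab beta)%:Z = 0.
  rewrite -mulr_natr natz in Esum.
  have -> : r = #|gT|%:Z * (fstab alpha)%:Z - m2 * #|forb beta|%:Z.
    by rewrite -Esum addrAC addrN add0r.
  by rewrite -oE !PoszM; ring.
have d_ge0 : 0 <= m2 - (fstab alpha * fstab beta)%N%:Z by rewrite subr_ge0.
have Gd_ge0 : 0 <= #|gT|%:Z * (m2 - (fstab alpha * fstab beta)%N%:Z).
  by rewrite mulr_ge0.
have rc_ge0 : 0 <= r * (fstab beta)%:Z by rewrite mulr_ge0.
move/eqP: key; rewrite paddr_eq0 // !mulf_eq0 subr_eq0 !eqz_nat.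
rewrite !gtn_eqF // orbF => /andP[/eqP -> /eqP r0].
split=> // beta' nz'; apply: contraT => ob'; case/eqP: nz'.
apply/eqP; rewrite -sqrf_eq0; move: r0 => /eqP.
rewrite psumr_eq0 => [/allP/(_ beta' (mem_index_enum _))|b _].
  by move=> /implyP/(_ ob').
exact: sqr_ge0.
Qed.

Lemma orth_col alpha beta x : bop x * x = 1 -> bmark (graph alpha beta) x != 0 ->
  bmark (graph alpha beta) x ^+ 2 = (fstab alpha * fstab beta)%N%:Z /\
  forall alpha', bmark (graph alpha' beta) x != 0 -> alpha' \in forb alpha.
Proof.
rewrite -{2}[x]bop_involutive => xx1 nz.
have nz' : bmark (graph beta alpha) (bop x) != 0 by rewrite bop_bmark.
have [E Ha] := orth_row xx1 nz'; rewrite bop_bmark in E.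
by split=> [|a' nza']; [rewrite E mulnC | apply: Ha; rewrite bop_bmark].
Qed.

Lemma bmarkM_neq0 alpha gamma x y : bmark (graph alpha gamma) (x * y) != 0 ->
  exists beta, bmark (graph alpha beta) x != 0 /\ bmark (graph beta gamma) y != 0.
Proof.
move=> nz; apply: contrapT => no; case/negP: nz.
have G0 : #|gT|%:Z != 0 by rewrite -lt0n; apply/card_gt0P; exists 1%g.
rewrite -(inj_eq (mulfI G0)) mulr0 bmarkM; apply/eqP/big1 => b _; apply/eqP.
rewrite mulf_eq0; apply: contraT; rewrite negb_or => /andP[nx ny].
by case: no; exists b.
Qed.

(** All nonzero terms of the product formula come from conjugates of beta, and these
terms are equal, so nothing cancels. *)
Lemma orth_comp alpha beta gamma x y : x * bop x = 1 ->
  bmark (graph alpha beta) x != 0 -> bmark (graph beta gamma) y != 0 ->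
  bmark (graph alpha gamma) (x * y) != 0.
Proof.
move=> xx1 nx ny; have [_ Hx] := orth_row xx1 nx.
apply: contraTneq isT => E; have := bmarkM alpha gamma x y.
rewrite E mulr0 (bigID (fun b => b \in forb beta)) /= addrC big1 => [|b nb].
  rewrite add0r (eq_bigr (fun=> bmark (graph alpha beta) x * bmark (graph beta gamma) y)).
    rewrite sumr_const => /esym/eqP.
    rewrite mulrn_eq0 mulf_eq0 (negPf nx) (negPf ny) orbF.
    by rewrite (cardD1 beta) orbit_refl.
  by move=> b ob; rewrite (bmark_orbitr _ _ ob) (bmark_orbitl _ _ ob).
apply/eqP; rewrite mulf_eq0; apply/orP; left; apply: contraR nb; apply: Hx.
Qed.

End Conjugation.
End OrthogonalMarks.

(** * Iota, eta and orthogonality *)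

Section UnitGroups.

Variable gT : finGroupType.
Local Notation gT2 := (gT * gT)%type.
Implicit Types (x y : bburnside gT) (u v : burnside gT) (phi psi : autG gT).

Lemma bmark1C (I : finType) (alpha beta : {ffun I -> gT}) :
  bmark (graph alpha beta) 1 = bmark (graph beta alpha) 1.
Proof.
rewrite !bmark1E; apply: (congr1 Posz); rewrite -[RHS](card_imset _ invg_inj).
apply: eq_card => g; rewrite -[g]invgK (mem_imset _ _ invg_inj) !in_set.
rewrite invgK; apply/eqP/eqP => <-; first exact: (actK (@fconj_action gT I)).
exact: (actKV (@fconj_action gT I)).
Qed.

Lemma bop1 : bop 1 = 1 :> bburnside gT.
Proof. by apply: bmark_inj => al be; rewrite bop_bmark bmark1C. Qed.

Lemma card_gT_neq0 : #|gT|%:Z != 0.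
Proof. by rewrite -lt0n; apply/card_gt0P; exists 1%g. Qed.

(** The form in which equality of marks is combined with the product formula. *)
Lemma bmarkM_inj x y :
  (forall alpha beta : {ffun gT2 -> gT}, #|gT|%:Z * bmark (graph alpha beta) x
    = #|gT|%:Z * bmark (graph alpha beta) y) -> x = y.
Proof. by move=> E; apply: bmark_inj => al be; apply: (mulfI card_gT_neq0). Qed.

Lemma bopM x y : bop (x * y) = bop y * bop x.
Proof.
apply: bmarkM_inj => al be; rewrite bop_bmark !bmarkM; apply: eq_bigr => ga _.
by rewrite !bop_bmark mulrC.
Qed.

(** Marks of B(G) are constant on conjugacy classes, and the mark of 1 vanishes at
pairs that are not conjugate. *)
Lemma bmark1_fmark (I : finType) (alpha beta : {ffun I -> gT}) u :
  bmark (graph alpha beta) 1 * fmark beta u = bmark (graph alpha beta) 1 * fmark alpha u.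
Proof.
have [->|] := eqVneq (bmark (graph alpha beta) 1) 0; first by rewrite !mul0r.
by rewrite bmark1_neq0 => /(fmark_orbit u) ->.
Qed.

Lemma fmarkM (I : finType) (alpha : {ffun I -> gT}) u v :
  fmark alpha (u * v) = fmark alpha u * fmark alpha v.
Proof. exact: gmarkM. Qed.

Lemma iota1 : iotaB 1 = 1 :> bburnside gT.
Proof. by apply: bmark_inj => al be; rewrite iota_bmark /fmark gmark1 mulr1. Qed.

(** Both sides are sums over a middle family; in each nonzero term this family is
conjugate to alpha, and the remaining factors are those of 1 * 1 = 1. *)
Lemma iotaM u v : iotaB (u * v) = iotaB u * iotaB v :> bburnside gT.
Proof.
apply: bmarkM_inj => al ga; rewrite iota_bmark fmarkM bmarkM mulrA.
rewrite -[X in bmark _ X]mulr1 bmarkM big_distrl; apply: eq_bigr => be _ /=.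
transitivity (bmark (graph be ga) 1 * fmark al u * (bmark (graph al be) 1 * fmark al v)).
  by ring.
by rewrite -bmark1_fmark !iota_bmark; ring.
Qed.

Lemma iota_inj : injective (@iotaB gT).
Proof.
move=> u v E; apply: gmark_inj => L.
pose al : {ffun gT -> gT} := [ffun a => if a \in L then a else 1%g].
have EL : [set al a | a : gT] = L :> {set gT}.
  apply/setP => b; apply/imsetP/idP => [[a _ ->]|Lb].
    by rewrite ffunE; case: ifP => // _; apply: group1.
  by exists b; rewrite // ffunE Lb.
have nz : bmark (graph al al) 1 != 0 by rewrite bmark1_neq0 orbit_refl.
by apply: (mulfI nz); have := iota_bmark al al u; rewrite E iota_bmark /fmark EL.
Qed.

Lemma bop_iota u : bop (iotaB u) = iotaB u :> bburnside gT.
Proof.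
by apply: bmark_inj => al be; rewrite bop_bmark !iota_bmark bmark1C bmark1_fmark.
Qed.

(** Marks of a unit are units of the integers. *)
Lemma burn_unit_sqr u : u \is a GRing.unit -> u * u = 1.
Proof.
move=> Uu; apply: gmark_inj => L; rewrite gmark1 gmarkM.
have /intUnitRing.unitzPl : gmark L u^-1 * gmark L u = 1.
  by rewrite -gmarkM mulVr // gmark1.
by rewrite qualifE => /orP[] /eqP ->.
Qed.

Local Notation orth x := (x * bop x = 1 /\ bop x * x = 1).

Lemma orth_unitr x : orth x -> x \is a GRing.unit /\ x^-1 = bop x.
Proof.
case=> E1 E2; have Ux : x \is a GRing.unit by apply/unitrP; exists (bop x).
by split=> //; rewrite -[LHS]mulr1 -E1 mulKr.
Qed.

Lemma orth1 : orth (1 : bburnside gT).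
Proof. by rewrite bop1 mulr1. Qed.

Lemma orthM x y : orth x -> orth y -> orth (x * y).
Proof.
move=> [x1 x2] [y1 y2]; rewrite bopM; split.
  by rewrite mulrA -[x * y * _]mulrA y1 mulr1.
by rewrite mulrA -[_ * bop x * x]mulrA x2 mulr1.
Qed.

Lemma orthV x : orth x -> orth (x^-1).
Proof. by move=> ox; have [_ ->] := orth_unitr ox; rewrite bop_involutive; case: ox. Qed.

(** Since iota(u) is its own opposite, both say that u^2 = 1. *)
Lemma orth_iota u : orth (iotaB u) <-> u \is a GRing.unit.
Proof.
rewrite bop_iota -iotaM -iota1; split=> [[/iota_inj E _]|/burn_unit_sqr -> //].
by apply/unitrP; exists u.
Qed.

Lemma eta_out_outc phi : eta_out (outc phi) = bbtrans (autdiag phi).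
Proof. exact: eta_elt. Qed.

(** Substituting phi(beta) for the middle family beta turns the product formula for
1 * 1 = 1 into the one for the product of the two twisted bisets. *)
Lemma autdiagM phi psi :
  bbtrans (autdiag phi) * bbtrans (autdiag psi) = bbtrans (autdiag (phi * psi)%g).
Proof.
apply: bmarkM_inj => al ga; rewrite bmarkM.
rewrite autdiag_bmark -[1]mulr1 bmarkM.
rewrite [RHS](reindex_inj (can_inj (fautoK phi))) /=.
apply: eq_bigr => be _; rewrite !autdiag_bmark; congr (_ * _).
rewrite -(bmark1_auto phi); congr (bmark (graph _ _) _).
by apply/ffunP => i; rewrite !ffunE autGM.
Qed.

Lemma autdiag1 : bbtrans (autdiag (1 : autG gT)%g) = 1.
Proof.
apply: bmark_inj => al be; rewrite autdiag_bmark; congr (bmark (graph _ _) _).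
by apply/ffunP => i; rewrite ffunE autG1.
Qed.

Lemma bop_autdiag phi : bop (bbtrans (autdiag phi)) = bbtrans (autdiag phi^-1%g).
Proof.
apply: bmark_inj => al be; rewrite bop_bmark !autdiag_bmark bmark1C.
by rewrite -[RHS](bmark1_auto phi) fautoV.
Qed.

Lemma eta_outM : {morph @eta_out gT : v w / (v * w)%g >-> v * w}.
Proof.
by move=> v w; rewrite -[v]out_reprK -[w]out_reprK -outcM !eta_out_outc autdiagM.
Qed.

Lemma eta_out1 : eta_out (1 : Out gT)%g = 1.
Proof.
by have -> : (1 : Out gT)%g = outc 1%g;
  rewrite ?eta_out_outc ?autdiag1 // /outc morph1.
Qed.

Lemma orth_eta w : orth (eta_out w : bburnside gT).
Proof.
by rewrite -[w]out_reprK eta_out_outc bop_autdiag !autdiagM mulgV mulVg autdiag1.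
Qed.

(** Substituting phi(beta) for the middle family on the right makes the two sums
agree term by term. *)
Lemma eta_iota phi u :
  bbtrans (autdiag phi) * iotaB u = iotaB (out_act (outc phi) u) * bbtrans (autdiag phi).
Proof.
apply: bmarkM_inj => al ga; rewrite !bmarkM.
rewrite [RHS](reindex_inj (can_inj (fautoK phi))) /=.
apply: eq_bigr => be _; rewrite !iota_bmark !autdiag_bmark bmark1_auto.
by rewrite -(bmark1_fmark al (fauto phi be)) out_act_fmark; ring.
Qed.

(** * The map rho on orthogonal units *)

Lemma zelt_inj : injective (@zelt (Out gT)).
Proof.
move=> v w /ffunP/(_ v); rewrite !ffunE eqxx.
by case: eqP.
Qed.

Lemma zelt_mulz (w v : Out gT) (e : int) : (zelt w *~ e) v = (v == w)%:R * e.
Proof.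
have D : {morph (fun a : zring (Out gT) => a v) : a b / a + b}.
  by move=> a b; rewrite ffunE.
have zE : zelt w v = (v == w)%:R by rewrite ffunE.
have natE n : (zelt w *+ n) v = (v == w)%:R * n%:Z.
  elim: n => [|n IHn]; first by rewrite mulr0n ffunE mulr0.
  by rewrite mulrSr D IHn zE intS; ring.
case: e => n; first exact: natE.
by rewrite NegzE mulrNz [LHS]ffunE -pmulrn natE mulrN.
Qed.

Lemma sign_zelt_inj (v w : Out gT) (e f : int) : is_sign e -> is_sign f ->
  zelt v *~ e = zelt w *~ f -> v = w /\ e = f.
Proof.
move=> se sf E; have /ffunP/(_ v) := E; rewrite !zelt_mulz eqxx mul1r.
case: eqP => [->|_]; first by rewrite mul1r.
by rewrite mul0r => e0; case: se; rewrite e0.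
Qed.

Lemma rho_eta w : rhoB (eta_out w : bburnside gT) = zelt w.
Proof. by rewrite -[w in LHS]out_reprK eta_out_outc rho_autdiag out_reprK. Qed.

Lemma eta_out_inj : injective (@eta_out gT).
Proof. by move=> v w /(congr1 (@rhoB gT)); rewrite !rho_eta => /zelt_inj. Qed.

Local Notation fam phi := (fauto phi (idfam gT)).
Local Notation idf := (idfam gT).

(** Reparametrising by psi: both sides list the pairs (phi(h), h). *)
Lemma graph_fam phi psi :
  graph (fam (phi * psi)%g) (fam psi) = graph (fam phi) idf.
Proof.
apply/setP => c; apply/imsetP/imsetP => -[i _ ->].
  by exists (psi i); rewrite // !ffunE autGM.
exists (autG_fun psi^-1%g i); rewrite // !ffunE autGM -[autG_fun psi _]autGM.
by rewrite mulgV autG1.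
Qed.

(** The mark of x^o x = 1 at the identity family is nonzero, hence so is a term of
its product formula; the factor of x in that term sits at an automorphism. *)
Lemma orth_fam x : orth x -> exists phi, bmark (graph (fam phi) idf) x != 0.
Proof.
case=> _ x2; have : bmark (graph idf idf) (bop x * x) != 0.
  by rewrite x2 bmark1_neq0 orbit_refl.
by case/bmarkM_neq0 => al [_ nz]; have [phi E] := bmark_fam nz; exists phi; rewrite -E.
Qed.

(** The column at the identity family has one nonzero entry up to conjugation, and
its square is |Z(G)|^2; dividing by |Z(G)| leaves a sign. *)
Lemma orth_rho x phi : orth x -> bmark (graph (fam phi) idf) x != 0 ->
  exists2 e : int, is_sign e & rhoB x = zelt (outc phi) *~ e.
Proof.
move=> [_ x2] nz; have [E H] := orth_col x2 nz.
set z := bmark (graph idf idf) 1.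
have zE : z = #|'C[fam phi | @fconj_action gT gT]%g|%:Z.
  by rewrite -bmark1_stab bmark1_auto.
have z0 : z != 0 by rewrite bmark1_neq0 orbit_refl.
rewrite PoszM -zE -bmark1_stab -/z -rho_bmark -/z in E.
have e2 : (rhoB x (outc phi)) ^+ 2 = 1.
  by apply: (mulIf (mulf_neq0 z0 z0)); rewrite mul1r -[RHS]E exprMn expr2.
exists (rhoB x (outc phi)).
  by move/eqP: e2; rewrite sqrf_eq1 => /orP[] /eqP ->; [left | right].
apply/ffunP => w; rewrite -[w]out_reprK; set psi := out_repr w.
rewrite zelt_mulz; case: eqP => [->|nE]; first by rewrite mul1r.
rewrite mul0r; apply/eqP; apply: contraT => nz'; case: nE; apply/esym/fam_orbit/H.
by rewrite -rho_bmark mulf_neq0.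
Qed.

Lemma opi_eq x w (e : int) : is_sign e -> rhoB x = zelt w *~ e -> opi x = w.
Proof.
move=> se E; rewrite /opi; case: pickP => [v Hv|/(_ w)]; last first.
  by rewrite E; case: se => ->; rewrite ?mulrN1z ?mulr1z !eqxx ?orbT.
have [f sf Ef] : exists2 f : int, is_sign f & rhoB x = zelt v *~ f.
  case/orP: Hv => /eqP Hv; [exists 1 | exists (-1)]; rewrite ?mulrN1z //;
  by [left | right].
by rewrite E in Ef; have [] := sign_zelt_inj sf se (esym Ef).
Qed.

End UnitGroups.

(** * Conjugates of iota(B(G)) by orthogonal units *)

Section Normality.

Variable gT : finGroupType.
Local Notation gT2 := (gT * gT)%type.
Implicit Types (x y : bburnside gT) (u v : burnside gT).
Local Notation orth x := (x * bop x = 1 /\ bop x * x = 1).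

(** Membership in the family of subgroups of (G x G)-conjugates of Delta(G); the
second coordinate alone suffices to conjugate. *)
Definition subdiag (L : {group gT2}) : bool :=
  [exists g, L \subset [set c : gT2 | c.1 ^ g == c.2]%g].

Lemma subdiagS (K L : {group gT2}) : K \subset L -> subdiag L -> subdiag K.
Proof.
by move=> sKL /existsP[g sL]; apply/existsP; exists g; apply: subset_trans sL.
Qed.

Lemma subdiag_iota (L : {group gT2}) : subdiag L ->
  exists R, bbtrans L = iotaB (btrans R).
Proof.
case/existsP => g /subsetP HL.
(* This conjugate of L is contained in the diagonal. *)
pose D := (L :^ (1, g^-1)%g)%G.
have RG : group_set [set a | (a, a) \in D].
  apply/group_setP; split; first by rewrite inE group1.
  by move=> a b; rewrite !inE => Da Db; apply: (groupM Da Db).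
exists (Group RG); rewrite iota_trans -(bbtransJ L (1, g^-1)%g); congr bbtrans.
apply/val_inj/setP => -[a b]; rewrite mem_diag /= inE.
apply/idP/andP => [Dab|[/eqP -> //]].
have Eab : a = b.
  move: Dab; rewrite -/(gval D) mem_conjg => /HL; rewrite inE /=.
  by rewrite !conjgE !invgK !invg1 !mul1g !mulg1 => /eqP/mulgI/mulIg.
by rewrite -Eab in Dab *.
Qed.

Lemma stab_subdiag_iota (T : finType) (to : {action gT2 &-> T}) (fr : bifree to) :
  (forall t, subdiag 'C[t | to]%G) -> exists u, bbclass fr = iotaB u.
Proof.
move: T to fr; apply: action_ind => [T1 T2 to1 to2 iso IH fr2 st|fr _|L T to IH fr st].
- have fr1 := iso_bifree (act_iso_sym iso) fr2.
  rewrite -(bbclass_iso fr1 fr2 iso); apply: IH => t.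
  case: iso => f /bij_inj fI fJ; have := st (f t); congr (is_true (subdiag _)).
  apply/val_inj/setP => c; apply/astab1P/astab1P; rewrite -fJ; last by move=> ->.
  exact: fI.
- exists 0; rewrite (morphD0 (@iotaBD gT)).
  by rewrite (bbclass_iso fr (bifree_void gT) (act_iso_refl _)).
have [frL frT] := bifree_sumP fr; have [stL stT] := sum_stab st.
have [u Eu] := IH frT stT.
have [R ER] : exists R, bbtrans L = iotaB (btrans R).
  apply: subdiag_iota; have := stL (coset_base L); congr (is_true (subdiag _)).
  exact/val_inj/coset_base_stab.
by exists (btrans R + u); rewrite (bbclass_sum frL frT) iotaBD -ER -Eu (bbtransE frL).
Qed.

(** Split off the common part relative to [subdiag]: it cancels in the difference,
and what remains has orbits of the form (G x G)/Delta(R) only. *)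
Lemma diag_marks_iota x :
    (forall alpha beta : {ffun gT2 -> gT}, bmark (graph alpha beta) x != 0 ->
      beta \in orbit (@fconj_action gT gT2) [set: gT] alpha) ->
  exists u, x = iotaB u.
Proof.
elim/groth_ind: x => a b; rewrite gpairE.
elim/bcl_ind: a => T1 to1 fr1; elim/bcl_ind: b => T2 to2 fr2 H.
have [L nL|T [D1 [D2 [to [d1 [d2 [i1 i2 P1 P2]]]]]]] :=
    @common_part _ subdiag _ _ to1 to2 subdiagS.
  have [al [be EL]] := graph_group L.
  apply/eqP; rewrite -eqz_nat -(bmark_class _ fr1) -(bmark_class _ fr2) -subr_eq0.
  rewrite -(morphDB (@bmarkD _ _)) -EL; apply: contraR nL => /H /orbitP[g _ E].
  apply/existsP; exists g; rewrite -EL; apply/subsetP => _ /imsetP[i _ ->].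
  by rewrite inE /= -E ffunE.
have f1 := iso_bifree (act_iso_sym i1) fr1; have [frT frD1] := bifree_sumP f1.
have f2 := iso_bifree (act_iso_sym i2) fr2; have [_ frD2] := bifree_sumP f2.
have [u1 E1] := stab_subdiag_iota frD1 P1; have [u2 E2] := stab_subdiag_iota frD2 P2.
exists (u1 - u2); rewrite (morphDB (@iotaBD gT)) -E1 -E2 -!/(bbclass _).
rewrite -(bbclass_iso f1 fr1 i1) -(bbclass_iso f2 fr2 i2).
by rewrite (bbclass_sum frT frD1) (bbclass_sum frT frD2) opprD addrACA subrr add0r.
Qed.

(** A nonzero mark of the conjugate at (alpha, delta) leads through conjugate middle
families to two nonzero entries of x in one column, at alpha and at delta. *)
Lemma iota_conj x u : orth x -> exists v, x * iotaB u * bop x = iotaB v.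
Proof.
move=> [_ x2]; apply: diag_marks_iota => al de /bmarkM_neq0[be [nz1]].
rewrite bop_bmark => nzd; have [be' [nza]] := bmarkM_neq0 nz1.
rewrite iota_bmark mulf_eq0 negb_or => /andP[+ _]; rewrite bmark1_neq0 => ob.
rewrite -(bmark_orbitr al x ob) in nza.
by have [_] := orth_col x2 nza; apply.
Qed.

(** * Multiplicativity of pi *)

(** The value of pi can be recognised from any single nonzero mark at an
automorphism; this is how products and images of iota are handled. *)
Lemma opi_marks x : orth x ->
  exists2 phi, bmark (graph (fauto phi (idfam gT)) (idfam gT)) x != 0 & opi x = outc phi.
Proof.
move=> ox; have [phi nz] := orth_fam ox; exists phi => //.
by have [e se E] := orth_rho ox nz; apply: opi_eq se E.
Qed.

Lemma opi_outc x phi : orth x ->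
  bmark (graph (fauto phi (idfam gT)) (idfam gT)) x != 0 -> opi x = outc phi.
Proof. by move=> ox nz; have [e se E] := orth_rho ox nz; apply: opi_eq se E. Qed.

Lemma opiM x y : orth x -> orth y -> opi (x * y) = (opi x * opi y)%g.
Proof.
move=> ox oy; have [phi nx ->] := opi_marks ox; have [psi ny ->] := opi_marks oy.
rewrite -outcM; apply: opi_outc; first exact: orthM.
by apply: orth_comp ny; [case: ox | rewrite graph_fam].
Qed.

Lemma opi_eta w : opi (eta_out w : bburnside gT) = w.
Proof. by apply: (@opi_eq _ _ _ 1); [left | rewrite rho_eta mulr1z]. Qed.

Lemma opi1 : opi (1 : bburnside gT) = 1%g.
Proof. by rewrite -eta_out1 opi_eta. Qed.

Lemma opiV x : orth x -> opi x^-1 = (opi x)^-1%g.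
Proof.
move=> ox; apply: (mulgI (opi x)); rewrite mulgV -opiM //; last exact: orthV.
by rewrite mulrV ?opi1 //; case: (orth_unitr ox).
Qed.

Lemma opi_iota u : u \is a GRing.unit -> opi (iotaB u : bburnside gT) = 1%g.
Proof.
move=> Uu; have ou := (orth_iota u).2 Uu; have [phi nz ->] := opi_marks ou.
move: nz; rewrite iota_bmark mulf_eq0 negb_or bmark1_neq0 => /andP[+ _].
rewrite orbit_sym => of_; have /fam_orbit <- : fauto phi (idfam gT) \in
    orbit (@fconj_action gT gT) [set: gT] (fauto 1%g (idfam gT)).
  suff -> : fauto 1%g (idfam gT) = idfam gT by [].
  by apply/ffunP => i; rewrite !ffunE autG1.
by rewrite /outc morph1.
Qed.

End Normality.

(** * The subgroups of the orthogonal unit group *)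

From mathcomp Require Import classical_sets.
Local Open Scope classical_set_scope.

Section OrthogonalGroup.

Variable gT : finGroupType.
Let BO : set (bburnside gT) := @orth_units gT.
Let iotaU : set (bburnside gT) := @iotaB gT @` @burn_units gT.
Let Lambda : set (bburnside gT) := [set x | BO x /\ opi x = 1%g].
Let Delta : set (bburnside gT) := range (@eta_out gT).

Lemma unit_group_BO : unit_group BO.
Proof.
split=> [x /orth_unitr[]|||] //; [exact: orth1 | exact: orthM | exact: orthV].
Qed.

Lemma subgroup_ofP (K : set (bburnside gT)) : K `<=` BO -> K 1 ->
    (forall x y, K x -> K y -> K (x * y)) -> (forall x, K x -> K x^-1) ->
  subgroup_of K BO.
Proof.
move=> KB K1 KM KV; split=> //; last exact: unit_group_BO.
by split=> // x /KB /orth_unitr[].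
Qed.

Lemma iotaU_BO : iotaU `<=` BO.
Proof. by move=> _ [u Uu <-]; apply/orth_iota. Qed.

Lemma iotaU_eq : iotaU = range (@iotaB gT) `&` BO.
Proof.
apply/seteqP; split=> [x Ux|_ [[u _ <-] /orth_iota Uu]]; last by exists u.
by split; [case: Ux => u _ <-; exists u | apply: iotaU_BO].
Qed.

(** Conjugates stay in iota(B(G)) and in the orthogonal units, and these two sets
intersect in the image of the units. *)
Lemma normal_iotaU : normal_in iotaU BO.
Proof.
have memU u : BO (iotaB u) -> iotaU (iotaB u) by move=> /orth_iota Uu; exists u.
split.
  apply: subgroup_ofP => [||_ _ [u Uu <-] [v Uv <-]|_ [u Uu <-]].
  - exact: iotaU_BO.
  - by rewrite -iota1; apply: memU; rewrite iota1; apply: orth1.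
  - by rewrite -iotaM; apply: memU; rewrite iotaM; apply: orthM; apply/orth_iota.
  have ou := (orth_iota u).2 Uu; have [_ ->] := orth_unitr ou.
  by rewrite bop_iota; apply: memU.
move=> _ x [u Uu <-] ox; have ou := (orth_iota u).2 Uu.
have oz : BO (x * iotaB u * x^-1) by apply: orthM (orthM ox ou) (orthV ox).
have [_ xV] := orth_unitr ox; have [v Ev] := iota_conj u ox.
by rewrite xV Ev in oz *; apply: memU.
Qed.

Lemma normal_Lambda : normal_in Lambda BO.
Proof.
split.
  apply: subgroup_ofP => [x []||x y [ox x1] [oy y1]|x [ox x1]] //.
  - by split; [exact: orth1 | exact: opi1].
  - by split; [exact: orthM | rewrite opiM // x1 y1 mulg1].
  by split; [exact: orthV | rewrite opiV // x1 invg1].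
move=> x y [ox x1] oy; have ov := orthV oy; have oyx := orthM oy ox.
split; first exact: orthM.
by rewrite opiM // opiM // opiV // x1 mulg1 mulgV.
Qed.

Lemma eta_outV w : (eta_out w)^-1 = eta_out w^-1%g :> bburnside gT.
Proof.
have [U _] := orth_unitr (orth_eta w).
by apply: (mulrI U); rewrite mulrV // -eta_outM mulgV eta_out1.
Qed.

Lemma subgroup_Delta : subgroup_of Delta BO.
Proof.
apply: subgroup_ofP => [_ [w _ <-]||_ _ [v _ <-] [w _ <-]|_ [w _ <-]].
- exact: orth_eta.
- by exists 1%g => //; apply: eta_out1.
- by exists (v * w)%g => //; apply: eta_outM.
by exists w^-1%g => //; rewrite eta_outV.
Qed.

Lemma subgroup_iotaU_Lambda : subgroup_of iotaU Lambda.
Proof.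
have [[UU _ _] _] := normal_iotaU; have [[UL _ _] _] := normal_Lambda.
split=> // _ [u Uu <-]; split; last exact: opi_iota.
by apply: iotaU_BO; exists u.
Qed.

(** Eta is a section of pi, so x factors as (x eta(pi x)^-1) eta(pi x). *)
Lemma semidirect_Lambda_Delta : semidirect BO Lambda Delta.
Proof.
split; [exact: normal_Lambda | exact: subgroup_Delta | |].
  apply/seteqP; split=> [x [[_ w1] [w _ Ew]]|_ ->].
    by move: w1; rewrite -Ew opi_eta => ->; rewrite eta_out1.
  by split; [split; [exact: orth1 | exact: opi1] | exists 1%g => //; apply: eta_out1].
apply/seteqP; split=> [x ox|_ [x [ox _] [_ [w _ <-] <-]]]; last first.
  exact: orthM ox (orth_eta w).
have oe := orth_eta (opi x); have [U _] := orth_unitr oe.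
exists (x * (eta_out (opi x))^-1); last first.
  by exists (eta_out (opi x)); [exists (opi x) | rewrite mulrVK].
split; first by apply: orthM ox (orthV oe).
by rewrite opiM ?opiV ?opi_eta ?mulgV //; apply: orthV.
Qed.

End OrthogonalGroup.

Theorem lemma3p2 (gT : finGroupType) :
  let BO : set (bburnside gT) := @orth_units gT in
  let iotaU : set (bburnside gT) := @iotaB gT @` @burn_units gT in
  let Lambda : set (bburnside gT) := [set x | BO x /\ opi x = 1%g] in
  let Delta : set (bburnside gT) := range (@eta_out gT) in
  [/\ (* (a) *)
      iotaU = range (@iotaB gT) `&` BO /\ normal_in iotaU BO,
      (* (b) *)
      [/\ forall w : Out gT, BO (eta_out w),
          {morph @eta_out gT : v w / (v * w)%g >-> v * w}
        & injective (@eta_out gT)],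
      (* (c) *)
      (forall x, BO x -> exists! p : Out gT * int,
         is_sign p.2 /\ rhoB x = zelt p.1 *~ p.2)
      /\ [/\ forall x, BO x -> exists2 e : int, is_sign e & rhoB x = zelt (opi x) *~ e,
             forall x y, BO x -> BO y -> opi (x * y) = (opi x * opi y)%g,
             forall w : Out gT, exists2 x, BO x & opi x = w
           & forall w : Out gT, opi (eta_out w) = w],
      (* (d) *)
      [/\ normal_in Lambda BO, subgroup_of Delta BO, subgroup_of iotaU Lambda
        & semidirect BO Lambda Delta]
    & (* (e) *)
      forall (w : Out gT) (u : burnside gT), burn_units u ->
        eta_out w * iotaB u * (eta_out w)^-1 = iotaB (out_act w u)].
Proof.
have rhoE (x : bburnside gT) : orth_units x ->
    exists2 e : int, is_sign e & rhoB x = zelt (opi x) *~ e.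
  by move=> ox; have [phi nz ->] := opi_marks ox; apply: orth_rho nz.
split.
- by split; [exact: iotaU_eq | exact: normal_iotaU].
- by split; [exact: orth_eta | exact: eta_outM | exact: eta_out_inj].
- split=> [x ox|].
    have [e se E] := rhoE x ox; exists (opi x, e); split=> // -[w f] [/= sf Ef].
    by rewrite E in Ef; have [-> ->] := sign_zelt_inj se sf Ef.
  split=> //; [exact: opiM | | exact: opi_eta].
  by move=> w; exists (eta_out w); [exact: orth_eta | exact: opi_eta].
- split; [exact: normal_Lambda | exact: subgroup_Delta
  | exact: subgroup_iotaU_Lambda | exact: semidirect_Lambda_Delta].
move=> w u _; have [U _] := orth_unitr (orth_eta w).
apply: (mulIr U); rewrite mulrVK //.
by rewrite -[w]out_reprK eta_out_outc eta_iota.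
Qed.
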